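(* Assume (A1)–(A3) for problem (DC) and that $\theta$ is coercive on $\Xi$ (i.e., $\theta(\mathbf x)\to+\infty$ as $\|\mathbf x\|\to\infty$ with $\mathbf x\in\Xi$). Let $\boldsymbol\tau\ge\mathbf 0$ with $c_{\boldsymbol\tau}>0$. Consider Algorithm 2: given $\mathbf x^0\in\Xi$, step sizes $\{\gamma^\nu\}$ and accuracies $\{\varepsilon^\nu\}$ with $\varepsilon^\nu\downarrow0$, at each $\nu$ pick $\mathbf z^\nu\in\Xi$ with $\|\mathbf z^\nu-\hat{\mathbf x}(\mathbf x^\nu)\|\le\varepsilon^\nu$ and set $\mathbf x^{\nu+1}=\mathbf x^\nu+\gamma^\nu(\mathbf z^\nu-\mathbf x^\nu)$. Suppose (i) $\gamma^\nu\in(0,1]$; (ii) $\gamma^\nu\to0$; (iii) $\sum_\nu\gamma^\nu=+\infty$; (iv) $\sum_\nu(\gamma^\nu)^2<+\infty$; (v) $\sum_\nu\varepsilon^\nu\gamma^\nu<+\infty$. Then either $\mathbf x^\nu$ is a stationary point of (DC) for some finite $\nu$, or $\{\mathbf x^\nu\}$ has at least one limit point and every limit point is a stationary point of (DC).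
   Context: Let $I\ge1$, $n_1,\dots,n_I\ge1$, $n=\sum_i n_i$. Vectors $\mathbf x\in\mathbb R^n$ are partitioned as $\mathbf x=(\mathbf x_i)_{i=1}^I$, $\mathbf x_i\in\mathbb R^{n_i}$; $\mathbf x_{-i}=(\mathbf x_j)_{j\ne i}$, and $(\mathbf x_i,\mathbf y_{-i})$ is the vector with $i$-th block $\mathbf x_i$ and $j$-th block $\mathbf y_j$ for $j\neq i$. Given sets $\mathcal X_i\subseteq\mathbb R^{n_i}$, functions $f_i,g_i:\mathbb R^n\to\mathbb R$ and $\mathbf h=(h_1,\dots,h_{n_c}):\mathbb R^n\to\mathbb R^{n_c}$, problem (DC) is: minimize $\theta(\mathbf x)=\sum_{i=1}^I(f_i(\mathbf x)-g_i(\mathbf x))$ subject to $\mathbf x_i\in\mathcal X_i$ for all $i$ and $\mathbf h(\mathbf x)\le\mathbf 0$. Let $\mathcal X=\prod_i\mathcal X_i$, $\mathcal X_{-i}=\prod_{j\ne i}\mathcal X_j$, $\Xi=\{\mathbf x\in\mathcal X:\mathbf h(\mathbf x)\le\mathbf 0\}$, assumed nonempty. Assumptions: (A1) each $f_i,g_i,h_j$ is convex and continuously differentiable on an open set containing $\mathcal X$; (A2) each $\mathcal X_i$ is nonempty, closed, convex; (A3) $\nabla f_i$, $\nabla g_i$ are Lipschitz continuous on $\mathcal X$. A stationary point of (DC) is $\mathbf x^\star\in\Xi$ with $\nabla\theta(\mathbf x^\star)^T(\mathbf y-\mathbf x^\star)\ge0$ for all $\mathbf y\in\Xi$. For each $i$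 and $\mathbf x_{-i}\in\mathcal X_{-i}$, $c_{f_i}(\mathbf x_{-i})\ge0$ is the largest constant such that $(\mathbf z_i-\mathbf w_i)^T(\nabla_{\mathbf x_i}f_i(\mathbf z_i,\mathbf x_{-i})-\nabla_{\mathbf x_i}f_i(\mathbf w_i,\mathbf x_{-i}))\ge c_{f_i}(\mathbf x_{-i})\|\mathbf z_i-\mathbf w_i\|^2$ for all $\mathbf z_i,\mathbf w_i\in\mathcal X_i$. For $\boldsymbol\tau\ge\mathbf 0$, $c_{\boldsymbol\tau}:=\min_{i}\{\tau_i+\inf_{\mathbf z_{-i}\in\mathcal X_{-i}}c_{f_i}(\mathbf z_{-i})\}$. For $\mathbf y\in\mathcal X$ let $\tilde\theta(\mathbf x;\mathbf y)=\sum_i\tilde\theta_i(\mathbf x_i;\mathbf y)$ with $\tilde\theta_i(\mathbf x_i;\mathbf y)=f_i(\mathbf x_i,\mathbf y_{-i})+\sum_{j\ne i}\nabla_{\mathbf x_i}f_j(\mathbf y)^T(\mathbf x_i-\mathbf y_i)-g_i(\mathbf y)-\sum_{j=1}^I\nabla_{\mathbf x_i}g_j(\mathbf y)^T(\mathbf x_i-\mathbf y_i)+\tfrac{\tau_i}{2}\|\mathbf x_i-\mathbf y_i\|^2.$ When $c_{\boldsymbol\tau}>0$, $\hat{\mathbf x}(\mathbf y):=\arg\min_{\mathbf x\in\Xi}\tilde\theta(\mathbf x;\mathbf y)$ (the unique minimizer). *)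

(* Defs.v *)
From Stdlib Require Import Reals Lra Classical.
Open Scope R_scope.

(* A vector x of R^n = R^{n_1} x ... x R^{n_I} is represented blockwise:
   x i k is the k-th coordinate of the i-th block x_i (only i < I and
   k < nb i are meaningful; all norms/inner products only read those). *)
Definition bvec := nat -> R.
Definition vec := nat -> bvec.

Fixpoint fsum (m : nat) (f : nat -> R) : R :=
  match m with O => 0 | S m' => fsum m' f + f m' end.

Definition binner (d : nat) (u v : bvec) : R := fsum d (fun k => u k * v k).
Definition bnorm (d : nat) (u : bvec) : R := sqrt (binner d u u).
Definition bsub (u v : bvec) : bvec := fun k => u k - v k.

Definition inner (I : nat) (nb : nat -> nat) (x y : vec) : R :=
  fsum I (fun i => binner (nb i) (x i) (y i)).
Definition vnorm (I : nat) (nb : nat -> nat) (x : vec) : R := sqrt (inner I nb x x).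
Definition vadd (x y : vec) : vec := fun i k => x i k + y i k.
Definition vsub (x y : vec) : vec := fun i k => x i k - y i k.
Definition vscal (a : R) (x : vec) : vec := fun i k => a * x i k.

Definition upd (x : vec) (i : nat) (u : bvec) : vec :=
  fun j => if Nat.eqb j i then u else x j.

Definition inX (I : nat) (Xs : nat -> bvec -> Prop) (x : vec) : Prop :=
  forall i, (i < I)%nat -> Xs i (x i).
Definition inXminus (I : nat) (Xs : nat -> bvec -> Prop) (i : nat) (x : vec) : Prop :=
  forall j, (j < I)%nat -> j <> i -> Xs j (x j).
Definition inXi (I : nat) (Xs : nat -> bvec -> Prop) (nc : nat)
  (h : nat -> vec -> R) (x : vec) : Prop :=
  inX I Xs x /\ forall j, (j < nc)%nat -> h j x <= 0.

Definition bclosed (d : nat) (S : bvec -> Prop) : Prop :=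
  forall u, (forall e, e > 0 -> exists v, S v /\ bnorm d (bsub v u) < e) -> S u.
Definition bconvex (S : bvec -> Prop) : Prop :=
  forall u v t, S u -> S v -> 0 <= t <= 1 -> S (fun k => t * u k + (1 - t) * v k).

Definition open_set (I : nat) (nb : nat -> nat) (U : vec -> Prop) : Prop :=
  forall x, U x -> exists r, r > 0 /\ forall y, vnorm I nb (vsub y x) < r -> U y.
Definition has_grad_on (I : nat) (nb : nat -> nat) (U : vec -> Prop)
  (F : vec -> R) (G : vec -> vec) : Prop :=
  forall x, U x -> forall e, e > 0 -> exists d, d > 0 /\
    forall y, vnorm I nb (vsub y x) < d ->
      Rabs (F y - F x - inner I nb (G x) (vsub y x)) <= e * vnorm I nb (vsub y x).
Definition cont_on (I : nat) (nb : nat -> nat) (U : vec -> Prop) (G : vec -> vec) : Prop :=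
  forall x, U x -> forall e, e > 0 -> exists d, d > 0 /\
    forall y, U y -> vnorm I nb (vsub y x) < d -> vnorm I nb (vsub (G y) (G x)) < e.
Definition C1_near (I : nat) (nb : nat -> nat) (S : vec -> Prop)
  (F : vec -> R) (G : vec -> vec) : Prop :=
  exists U, open_set I nb U /\ (forall x, S x -> U x) /\
    has_grad_on I nb U F G /\ cont_on I nb U G.
Definition convex_on (S : vec -> Prop) (F : vec -> R) : Prop :=
  forall x y t, S x -> S y -> 0 <= t <= 1 ->
    F (vadd (vscal t x) (vscal (1 - t) y)) <= t * F x + (1 - t) * F y.
Definition lipschitz_on (I : nat) (nb : nat -> nat) (S : vec -> Prop) (G : vec -> vec) : Prop :=
  exists L, forall x y, S x -> S y ->
    vnorm I nb (vsub (G x) (G y)) <= L * vnorm I nb (vsub x y).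

Definition theta (I : nat) (f g : nat -> vec -> R) (x : vec) : R :=
  fsum I (fun i => f i x - g i x).
Definition grad_theta (I : nat) (gf gg : nat -> vec -> vec) (x : vec) : vec :=
  fun b k => fsum I (fun i => gf i x b k - gg i x b k).

Definition stationary (I : nat) (nb : nat -> nat) (Xs : nat -> bvec -> Prop) (nc : nat)
  (h : nat -> vec -> R) (gf gg : nat -> vec -> vec) (xs : vec) : Prop :=
  inXi I Xs nc h xs /\
  forall y, inXi I Xs nc h y -> inner I nb (grad_theta I gf gg xs) (vsub y xs) >= 0.

(* c is an admissible constant in the definition of c_{f_i}(x_{-i})
   (the block x i of x is irrelevant: it is overwritten by upd). *)
Definition cf_valid (nb : nat -> nat) (Xs : nat -> bvec -> Prop)
  (gf : nat -> vec -> vec) (i : nat) (x : vec) (c : R) : Prop :=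
  0 <= c /\ forall zi wi, Xs i zi -> Xs i wi ->
    binner (nb i) (bsub zi wi) (bsub (gf i (upd x i zi) i) (gf i (upd x i wi) i))
      >= c * (bnorm (nb i) (bsub zi wi)) ^ 2.
(* "c_{f_i}(x_{-i}) >= d", where c_{f_i}(x_{-i}) is the largest admissible
   constant, i.e. the least upper bound of the admissible constants
   (= +infinity, in which case the statement holds for every d, when
   there is no finite least upper bound). *)
Definition cf_ge (nb : nat -> nat) (Xs : nat -> bvec -> Prop)
  (gf : nat -> vec -> vec) (i : nat) (x : vec) (d : R) : Prop :=
  forall m, is_lub (cf_valid nb Xs gf i x) m -> d <= m.
(* c_tau > 0, where c_tau = min_i (tau_i + inf_{z_{-i} in X_{-i}} c_{f_i}(z_{-i})):
   there is c > 0 with c_tau >= c. *)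
Definition c_tau_pos (I : nat) (nb : nat -> nat) (Xs : nat -> bvec -> Prop)
  (gf : nat -> vec -> vec) (tau : nat -> R) : Prop :=
  exists c, c > 0 /\ forall i, (i < I)%nat -> forall z, inXminus I Xs i z ->
    cf_ge nb Xs gf i z (c - tau i).

Definition ttheta_i (I : nat) (nb : nat -> nat) (f g : nat -> vec -> R)
  (gf gg : nat -> vec -> vec) (tau : nat -> R) (y : vec) (i : nat) (xi : bvec) : R :=
  f i (upd y i xi)
  + fsum I (fun j => if Nat.eqb j i then 0
                     else binner (nb i) (gf j y i) (bsub xi (y i)))
  - g i y
  - fsum I (fun j => binner (nb i) (gg j y i) (bsub xi (y i)))
  + tau i / 2 * (bnorm (nb i) (bsub xi (y i))) ^ 2.
Definition ttheta (I : nat) (nb : nat -> nat) (f g : nat -> vec -> R)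
  (gf gg : nat -> vec -> vec) (tau : nat -> R) (y x : vec) : R :=
  fsum I (fun i => ttheta_i I nb f g gf gg tau y i (x i)).
Definition is_xhat (I : nat) (nb : nat -> nat) (Xs : nat -> bvec -> Prop) (nc : nat)
  (h : nat -> vec -> R) (f g : nat -> vec -> R) (gf gg : nat -> vec -> vec)
  (tau : nat -> R) (y xh : vec) : Prop :=
  inXi I Xs nc h xh /\
  forall x, inXi I Xs nc h x -> ttheta I nb f g gf gg tau y xh <= ttheta I nb f g gf gg tau y x.

Definition coercive_on (I : nat) (nb : nat -> nat) (S : vec -> Prop) (F : vec -> R) : Prop :=
  forall M, exists r, forall x, S x -> vnorm I nb x > r -> F x > M.

Definition limit_point (I : nat) (nb : nat -> nat) (xs : nat -> vec) (xl : vec) : Prop :=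
  forall e, e > 0 -> forall N, exists nu, (N <= nu)%nat /\ vnorm I nb (vsub (xs nu) xl) < e.

Definition series_converges (a : nat -> R) : Prop :=
  exists l, Un_cv (fun N => fsum N a) l.
Definition series_diverges (a : nat -> R) : Prop :=
  forall M, exists N0, forall N, (N0 <= N)%nat -> fsum N a > M.

(* Main.v *)
(* The natural Lyapunov function theta does not directly work: the inexactness contributes
   gam * eps * |grad theta(x^nu)|, and the gradient need not be bounded before the iterates
   are known to be bounded. Instead we follow the Moreau envelope
     Psi(x) = min over w in Xi of theta(w) + K/2 |w - x|^2,
   with minimizer p(x). Let q = p(x) - x and u = xhat(x) - x. Adding the two variational
   inequalities at p(x) and xhat(x) gives, for K large,
     K <q, u> >= c |q|^2 + c/2 |u - q|^2,
   so Psi decreases by a multiple of gam |u|^2 up to O(gam eps^2), the error eps |q| being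
   absorbed. Hence Psi, and by coercivity x^nu, stays bounded, and the sum of gam |u|^2 is
   finite. Since xhat is Lipschitz, |u|^2 increases by a summable amount per step, so it
   converges, to 0 because gam is not summable; the variational inequality for xhat then
   passes to the limit. *)
Require Import Defs.
From Stdlib Require Import Reals Lra Lia ClassicalEpsilon FunctionalExtensionality List.
Open Scope R_scope.

(** The argument is driven by one map T(w, y), the gradient in w of the surrogate built at y. It has
    three properties: T(x, x) is the gradient of theta, T is strongly monotone in w, and T is
    jointly Lipschitz. The iteration is therefore analysed for an abstract pair F, T on a closed
    convex set; the product structure of the constraints and of the surrogate enters only when these
    properties are verified. Since theta is not convex, p(x) need not be unique. Any minimizer
    serves, picked by choice for each iterate, because only its minimal value and its first-order
    condition are used. The residual is followed through its square because the sums under control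
    are those of gam |u|^2 and gam eps^2, while the sum of gam |u| may diverge. The sum of gam eps^2
    is finite because eps decreases, so gam eps^2 is at most eps^0 times the summable gam eps. *)

Lemma Rabs_le_inv a b : Rabs a <= b -> - b <= a <= b.
Proof. unfold Rabs. destruct Rcase_abs; lra. Qed.

Lemma sqr_le_double a b d : 0 <= a <= b + d -> a ^ 2 <= 2 * b ^ 2 + 2 * d ^ 2.
Proof. intros H. assert (H' := pow2_ge_0 (b - d)). nra. Qed.

(** One step of the squared residual. After expansion, g^2 <= g and C <= C^2 put all increments on
    the scale C^2 g; the cross term contributes 3 and the quadratic term 2, hence the factor 5. *)
Lemma sqr_le_perturbed u v e g C : 0 <= u -> 0 <= e -> 0 <= g <= 1 -> 1 <= C ->
  0 <= v <= u + C * (g * (u + e)) -> v ^ 2 <= u ^ 2 + 5 * C ^ 2 * (g * u ^ 2 + g * e ^ 2).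
Proof.
  intros Hu He Hg HC Hv.
  apply Rle_trans with ((u + C * (g * (u + e))) ^ 2); [apply pow_incr; lra|].
  assert (Hsq := pow2_ge_0 (u - e)).
  assert (Ha : 2 * u * (u + e) <= 3 * (u ^ 2 + e ^ 2)) by nra.
  assert (Hb : (u + e) ^ 2 <= 2 * (u ^ 2 + e ^ 2)) by nra.
  assert (HC2 : C <= C ^ 2) by nra.
  assert (Hgg : 0 <= g * g <= g) by nra.
  replace ((u + C * (g * (u + e))) ^ 2)
    with (u ^ 2 + C * g * (2 * u * (u + e)) + C ^ 2 * (g * g) * (u + e) ^ 2) by ring.
  assert (Hc1 : C * g * (2 * u * (u + e)) <= C ^ 2 * g * (3 * (u ^ 2 + e ^ 2))).
  { apply Rmult_le_compat; [nra|nra|nra|exact Ha]. }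
  assert (Hc2 : C ^ 2 * (g * g) * (u + e) ^ 2 <= C ^ 2 * g * (2 * (u ^ 2 + e ^ 2))).
  { apply Rmult_le_compat; [nra|apply pow2_ge_0| |exact Hb].
    apply Rmult_le_compat_l; lra. }
  lra.
Qed.

(** * Finite sums *)

Lemma fsum_ext m f g : (forall i, (i < m)%nat -> f i = g i) -> fsum m f = fsum m g.
Proof.
  induction m as [|m IH]; simpl; intros H; [reflexivity|].
  rewrite IH by (intros; apply H; lia). rewrite H by lia. reflexivity.
Qed.

Lemma fsum_le m f g : (forall i, (i < m)%nat -> f i <= g i) -> fsum m f <= fsum m g.
Proof.
  induction m as [|m IH]; simpl; intros H; [lra|].
  apply Rplus_le_compat; [apply IH; intros; apply H|apply H]; lia.
Qed.

Lemma fsum_zero m : fsum m (fun _ => 0) = 0.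
Proof. induction m as [|m IH]; simpl; [|rewrite IH]; lra. Qed.

Lemma fsum_eq0 m f : (forall i, (i < m)%nat -> f i = 0) -> fsum m f = 0.
Proof. intros H. rewrite <- (fsum_zero m). now apply fsum_ext. Qed.

Lemma fsum_nonneg m f : (forall i, (i < m)%nat -> 0 <= f i) -> 0 <= fsum m f.
Proof. intros H. rewrite <- (fsum_zero m). now apply fsum_le. Qed.

Lemma fsum_plus m f g : fsum m (fun i => f i + g i) = fsum m f + fsum m g.
Proof. induction m as [|m IH]; simpl; [|rewrite IH]; ring. Qed.

Lemma fsum_minus m f g : fsum m (fun i => f i - g i) = fsum m f - fsum m g.
Proof. induction m as [|m IH]; simpl; [|rewrite IH]; ring. Qed.

Lemma fsum_scal m a f : fsum m (fun i => a * f i) = a * fsum m f.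
Proof. induction m as [|m IH]; simpl; [|rewrite IH]; ring. Qed.

Lemma fsum_swap m n (f : nat -> nat -> R) :
  fsum m (fun i => fsum n (f i)) = fsum n (fun j => fsum m (fun i => f i j)).
Proof.
  induction m as [|m IH]; simpl; [now rewrite fsum_zero|].
  rewrite IH, <- fsum_plus. reflexivity.
Qed.

Lemma fsum_single m i f : (i < m)%nat -> (forall j, (j < m)%nat -> j <> i -> f j = 0) ->
  fsum m f = f i.
Proof.
  induction m as [|m IH]; simpl; intros Hi H; [lia|].
  destruct (Nat.eq_dec i m) as [->|Hne].
  - rewrite (fsum_ext m f (fun _ => 0)) by (intros; apply H; lia).
    rewrite fsum_zero; ring.
  - rewrite IH; [rewrite (H m) by lia; ring|lia|intros; apply H; lia].
Qed.

Lemma fsum_mono f m n : (forall i, 0 <= f i) -> (m <= n)%nat -> fsum m f <= fsum n f.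
Proof.
  intros H. induction 1 as [|n _ IH]; simpl; [lra|]. specialize (H n); lra.
Qed.

Lemma fsum_cv_zero m (F : nat -> nat -> R) :
  (forall i, (i < m)%nat -> Un_cv (fun n => F n i) 0) ->
  Un_cv (fun n => fsum m (F n)) 0.
Proof.
  induction m as [|m IH]; simpl; intros H.
  - intros e He. exists 0%nat. intros. unfold Rdist. rewrite Rminus_0_r, Rabs_R0. lra.
  - replace 0 with (0 + 0) by ring.
    apply CV_plus; [apply IH; intros|]; apply H; lia.
Qed.

(** * First-order conditions along a segment *)

Lemma derivable_pt_lim_fsum m (F : nat -> R -> R) (D : nat -> R) t :
  (forall i, (i < m)%nat -> derivable_pt_lim (F i) t (D i)) ->
  derivable_pt_lim (fun s => fsum m (fun i => F i s)) t (fsum m D).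
Proof.
  induction m as [|m IH]; simpl; intros H.
  - apply derivable_pt_lim_const.
  - apply (derivable_pt_lim_plus (fun s => fsum m (fun i => F i s)) (F m));
      [apply IH; intros|]; apply H; lia.
Qed.

Lemma derivable_pt_lim_quadratic b c : derivable_pt_lim (fun t => t * b + t * t * c) 0 b.
Proof.
  intros e He. assert (Hc := Rabs_pos c).
  assert (Hd : 0 < e / (1 + Rabs c)) by (apply Rdiv_lt_0_compat; lra).
  exists (mkposreal _ Hd). intros t Ht Htd. simpl in Htd.
  replace (((0 + t) * b + (0 + t) * (0 + t) * c - (0 * b + 0 * 0 * c)) / t - b)
    with (t * c) by (field; exact Ht).
  rewrite Rabs_mult. assert (0 < Rabs t) by now apply Rabs_pos_lt.
  apply (Rmult_lt_compat_r (1 + Rabs c)) in Htd; [|lra].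
  replace (e / (1 + Rabs c) * (1 + Rabs c)) with e in Htd by (field; lra). lra.
Qed.

(** The comparison is asked only for t in (0, 1], since a segment between two points of a convex set
    stays in the set only for such t. *)
Lemma derivable_pt_lim_le F D M :
  derivable_pt_lim F 0 D -> (forall t, 0 < t <= 1 -> F t <= F 0 + t * M) -> D <= M.
Proof.
  intros HD HF. apply Rnot_lt_le. intros Hlt.
  destruct (HD (D - M) ltac:(lra)) as [d Hd].
  set (t := Rmin (d / 2) 1).
  assert (Hd0 : 0 < d) by apply cond_pos.
  assert (Ht : 0 < t <= 1) by (unfold t, Rmin; destruct Rle_dec; lra).
  assert (Htd : t < d) by (unfold t, Rmin; destruct Rle_dec; lra).
  specialize (Hd t ltac:(lra) ltac:(rewrite Rabs_right; lra)).
  specialize (HF t Ht). rewrite Rplus_0_l in Hd.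
  apply Rabs_def2 in Hd.
  assert ((F t - F 0) / t <= M).
  { apply (Rmult_le_reg_r t); [lra|]. unfold Rdiv.
    rewrite Rmult_assoc, Rinv_l; lra. }
  lra.
Qed.

Lemma derivable_pt_lim_min F D :
  derivable_pt_lim F 0 D -> (forall t, 0 < t <= 1 -> F 0 <= F t) -> 0 <= D.
Proof.
  intros HD HF.
  enough (- D <= 0) by lra.
  apply (derivable_pt_lim_le (fun t => - F t)); [now apply derivable_pt_lim_opp|].
  intros t Ht. specialize (HF t Ht). lra.
Qed.

(** * Summable perturbations of monotone sequences *)

Lemma series_bounded a : (forall n, 0 <= a n) -> series_converges a ->
  exists B, forall n, fsum n a <= B.
Proof.
  intros Ha [l Hl]. exists l. intros n.
  apply (growing_ineq (fun n => fsum n a)); [|exact Hl].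
  intros k. simpl. specialize (Ha k). lra.
Qed.

Lemma bounded_tails s B e : (forall n, 0 <= s n) -> (forall n, fsum n s <= B) -> 0 < e ->
  exists N, forall n, (N <= n)%nat -> fsum n s - fsum N s <= e.
Proof.
  intros Hs HB He.
  destruct (completeness (fun t => exists n, t = fsum n s)) as [m [Hub Hlub]].
  { exists B. intros t [n ->]. auto. }
  { exists (fsum 0 s), 0%nat. reflexivity. }
  destruct (classic (exists N, m - e < fsum N s)) as [[N HN]|Hno].
  - exists N. intros n _. specialize (Hub (fsum n s) (ex_intro _ n eq_refl)). lra.
  - exfalso. enough (m <= m - e) by lra. apply Hlub. intros t [n ->].
    apply Rnot_lt_le. intros Hlt. apply Hno. exists n. exact Hlt.
Qed.

(** Telescoping. The recursion starts at N because the envelope descends only once the step size is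
    small. *)
Lemma almost_decreasing a b s m S N :
  (forall n, m <= a n) -> (forall n, 0 <= b n) -> (forall n, 0 <= s n) ->
  (forall n, fsum n s <= S) ->
  (forall n, (N <= n)%nat -> a (Datatypes.S n) <= a n - b n + s n) ->
  exists B, (forall n, (N <= n)%nat -> a n <= B) /\ (forall n, fsum n b <= B).
Proof.
  intros Ha Hb Hs HS H.
  assert (Hn : forall n, (N <= n)%nat -> a n + fsum n b <= a N + fsum N b + fsum n s).
  { induction 1 as [|n Hle IH].
    - assert (H0 := fsum_nonneg N s (fun i _ => Hs i)). lra.
    - simpl. specialize (H n Hle). lra. }
  (* One constant serves both conclusions: bounding the sum of b subtracts the lower bound m of a,
     whose sign is unknown. *)
  exists (a N + fsum N b + S + Rabs m).
  assert (Hm := Rle_abs (- m)). rewrite Rabs_Ropp in Hm. assert (Hm' := Rabs_pos m). split.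
  - intros n Hle. specialize (Hn n Hle). specialize (HS n).
    assert (H0 := fsum_nonneg n b (fun i _ => Hb i)). lra.
  - intros n. apply Rle_trans with (fsum (max N n) b); [apply fsum_mono; [auto|lia]|].
    specialize (Hn (max N n) ltac:(lia)). specialize (HS (max N n)).
    specialize (Ha (max N n)). lra.
Qed.

(** Beyond an index where the tail of s is below e/2, V must fall under e/2 somewhere, otherwise the
    sum of gam V diverges with that of gam. From there it can regain at most e/2. *)
Lemma weighted_summable_cv_zero V s gam B :
  (forall n, 0 <= V n) -> (forall n, 0 <= s n) -> (forall n, 0 <= gam n) ->
  (forall n, V (S n) <= V n + s n) -> (forall n, fsum n s <= B) ->
  (forall n, fsum n (fun k => gam k * V k) <= B) -> series_diverges gam ->
  Un_cv V 0.
Proof.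
  intros HV Hs Hg HVs HB HgV Hdiv e He.
  destruct (bounded_tails s B (e / 2) Hs HB ltac:(lra)) as [N HN].
  assert (Hex : exists n, (N <= n)%nat /\ V n < e / 2).
  { apply NNPP. intros Hno.
    assert (Hge : forall n, (N <= n)%nat -> e / 2 <= V n).
    { intros n Hn. apply Rnot_lt_le. intros Hlt. apply Hno. exists n. auto. }
    (* Beyond this threshold, the terms after N alone would push the sum of gam V above B. *)
    destruct (Hdiv (fsum N gam + 2 * B / e)) as [M HM].
    assert (H : forall n, (N <= n)%nat ->
      e / 2 * (fsum n gam - fsum N gam) <= fsum n (fun k => gam k * V k)).
    { induction 1 as [|n Hle IH]; simpl.
      - rewrite Rminus_diag_eq by reflexivity. rewrite Rmult_0_r.
        apply fsum_nonneg. intros. now apply Rmult_le_pos.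
      - specialize (Hge n Hle). specialize (Hg n). nra. }
    specialize (H (max N M) ltac:(lia)). specialize (HgV (max N M)).
    specialize (HM (max N M) ltac:(lia)).
    apply (Rmult_gt_compat_l (e / 2)) in HM; [|lra].
    replace (e / 2 * (fsum N gam + 2 * B / e)) with (e / 2 * fsum N gam + B) in HM
      by (field; lra).
    lra. }
  destruct Hex as (n & Hn & HVn). exists n. intros k Hk.
  assert (H : V k <= V n + (fsum k s - fsum n s)).
  { unfold ge in Hk. induction Hk as [|k Hk IH]; simpl; [lra|]. specialize (HVs k). lra. }
  assert (HNk := HN k ltac:(lia)).
  assert (fsum N s <= fsum n s) by (apply fsum_mono; auto).
  unfold Rdist. rewrite Rminus_0_r, Rabs_right by (apply Rle_ge, HV). lra.
Qed.

(** * Euclidean geometry of block vectors *)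

Section EuclideanBlocks.
Context (I : nat) (nb : nat -> nat).
Local Notation inn := (inner I nb).
Local Notation nrm := (vnorm I nb).

Lemma inner_ext x x' y y' :
  (forall i k, (i < I)%nat -> (k < nb i)%nat -> x i k = x' i k /\ y i k = y' i k) ->
  inn x y = inn x' y'.
Proof.
  intros H. apply fsum_ext; intros i Hi. apply fsum_ext; intros k Hk.
  destruct (H i k Hi Hk) as [-> ->]. reflexivity.
Qed.

Lemma inner_sym x y : inn x y = inn y x.
Proof. do 2 (apply fsum_ext; intros). ring. Qed.

Lemma inner_vadd_l x y v : inn (vadd x y) v = inn x v + inn y v.
Proof.
  unfold inner. rewrite <- fsum_plus. apply fsum_ext; intros.
  unfold binner. rewrite <- fsum_plus. apply fsum_ext; intros. unfold vadd. ring.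
Qed.

Lemma inner_vscal_l a x v : inn (vscal a x) v = a * inn x v.
Proof.
  unfold inner. rewrite <- fsum_scal. apply fsum_ext; intros.
  unfold binner. rewrite <- fsum_scal. apply fsum_ext; intros. unfold vscal. ring.
Qed.

Lemma inner_vsub_l x y v : inn (vsub x y) v = inn x v - inn y v.
Proof.
  unfold inner. rewrite <- fsum_minus. apply fsum_ext; intros.
  unfold binner. rewrite <- fsum_minus. apply fsum_ext; intros. unfold vsub. ring.
Qed.

Lemma inner_vadd_r x y v : inn v (vadd x y) = inn v x + inn v y.
Proof. rewrite inner_sym, inner_vadd_l, !(inner_sym v). reflexivity. Qed.

Lemma inner_vscal_r a x v : inn v (vscal a x) = a * inn v x.
Proof. rewrite inner_sym, inner_vscal_l, (inner_sym v). reflexivity. Qed.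

Lemma inner_vsub_r x y v : inn v (vsub x y) = inn v x - inn v y.
Proof. rewrite inner_sym, inner_vsub_l, !(inner_sym v). reflexivity. Qed.

Lemma inner_nonneg x : 0 <= inn x x.
Proof. do 2 (apply fsum_nonneg; intros). nra. Qed.

Lemma vnorm_nonneg x : 0 <= nrm x.
Proof. apply sqrt_pos. Qed.

Lemma vnorm_sqr x : nrm x ^ 2 = inn x x.
Proof. unfold vnorm. rewrite <- Rsqr_pow2. apply Rsqr_sqrt, inner_nonneg. Qed.

Lemma vnorm_ext x y :
  (forall i k, (i < I)%nat -> (k < nb i)%nat -> x i k = y i k) -> nrm x = nrm y.
Proof. intros H. unfold vnorm. f_equal. apply inner_ext. auto. Qed.

Lemma vnorm_le x y :
  (forall i k, (i < I)%nat -> (k < nb i)%nat -> Rabs (x i k) <= Rabs (y i k)) ->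
  nrm x <= nrm y.
Proof.
  intros H. apply sqrt_le_1_alt. apply fsum_le; intros i Hi. apply fsum_le; intros k Hk.
  apply Rsqr_le_abs_1. auto.
Qed.

Lemma vnorm_vscal a x : nrm (vscal a x) = Rabs a * nrm x.
Proof.
  unfold vnorm. rewrite inner_vscal_l, inner_vscal_r, <- Rmult_assoc.
  rewrite sqrt_mult_alt by nra. f_equal. apply sqrt_Rsqr_abs.
Qed.

Lemma vnorm_vsub_sym x y : nrm (vsub x y) = nrm (vsub y x).
Proof. apply Rle_antisym; apply vnorm_le; intros; unfold vsub; rewrite Rabs_minus_sym; lra. Qed.

Lemma vnorm_vsub_self x : nrm (vsub x x) = 0.
Proof.
  rewrite (vnorm_ext _ (vscal 0 x)) by (intros; unfold vsub, vscal; ring).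
  rewrite vnorm_vscal, Rabs_R0. ring.
Qed.

Lemma cauchy_schwarz x y : Rabs (inn x y) <= nrm x * nrm y.
Proof.
  rewrite <- (Rabs_right (nrm x * nrm y)).
  2: apply Rle_ge, Rmult_le_pos; apply vnorm_nonneg.
  apply Rsqr_le_abs_0. rewrite !Rsqr_pow2, Rpow_mult_distr, !vnorm_sqr.
  assert (H := inner_nonneg (vsub (vscal (inn y y) x) (vscal (inn x y) y))).
  repeat rewrite ?inner_vsub_l, ?inner_vsub_r, ?inner_vscal_l, ?inner_vscal_r in H.
  rewrite (inner_sym y x) in H.
  assert (Hx := inner_nonneg x). assert (Hy := inner_nonneg y).
  (* For |y| > 0, [H] is |y|^2 times the claim. For |y| = 0, |x|^2 + t <x, y> stays nonnegative for
     every t, which forces <x, y> = 0. *)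
  destruct (Rle_lt_or_eq_dec _ _ Hy) as [Hy'|Hy']; [nra|].
  assert (Hxy : forall t, 0 <= inn x x + t * inn x y).
  { intros t. assert (H' := inner_nonneg (vadd x (vscal (t / 2) y))).
    repeat rewrite ?inner_vadd_l, ?inner_vadd_r, ?inner_vscal_l, ?inner_vscal_r in H'.
    rewrite (inner_sym y x), <- Hy' in H'. nra. }
  assert (H1 := Hxy (- (inn x x + 1) * inn x y)).
  assert (inn x y ^ 2 * inn x x + inn x y ^ 2 <= inn x x) by nra.
  assert (H2 : inn x y = 0).
  { apply NNPP. intros Hn.
    specialize (Hxy (- (inn x x + 1) / inn x y)).
    replace (- (inn x x + 1) / inn x y * inn x y) with (- (inn x x + 1)) in Hxy by (field; auto).
    lra. }
  rewrite H2. nra.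
Qed.

Lemma inner_ge_neg x y : - (nrm x * nrm y) <= inn x y.
Proof.
  assert (H := cauchy_schwarz x y). assert (H' := Rle_abs (- inn x y)).
  rewrite Rabs_Ropp in H'. lra.
Qed.

Lemma inner_le x y : inn x y <= nrm x * nrm y.
Proof. eapply Rle_trans; [apply Rle_abs|apply cauchy_schwarz]. Qed.

Lemma vnorm_vadd x y : nrm (vadd x y) <= nrm x + nrm y.
Proof.
  assert (Hx := vnorm_nonneg x). assert (Hy := vnorm_nonneg y).
  apply Rsqr_incr_0_var; [|lra].
  rewrite !Rsqr_pow2, vnorm_sqr, inner_vadd_l, !inner_vadd_r, (inner_sym y x).
  assert (H := inner_le x y). assert (H1 := vnorm_sqr x). assert (H2 := vnorm_sqr y). nra.
Qed.

Lemma vnorm_vsub_triangle y x w : nrm (vsub x w) <= nrm (vsub x y) + nrm (vsub y w).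
Proof.
  rewrite (vnorm_ext _ (vadd (vsub x y) (vsub y w))) by (intros; unfold vsub, vadd; ring).
  apply vnorm_vadd.
Qed.

Lemma coord_le_vnorm x i k : (i < I)%nat -> (k < nb i)%nat -> Rabs (x i k) <= nrm x.
Proof.
  intros Hi Hk. rewrite <- sqrt_Rsqr_abs. apply sqrt_le_1_alt.
  set (e := fun j l => if Nat.eqb j i then if Nat.eqb l k then x i k else 0 else 0).
  apply Rle_trans with (inn e e).
  - unfold inner. rewrite (fsum_single I i); [|exact Hi|].
    + unfold binner. rewrite (fsum_single _ k); [|exact Hk|].
      * unfold e. rewrite !Nat.eqb_refl. apply Rle_refl.
      * intros l _ Hl. unfold e. rewrite (proj2 (Nat.eqb_neq l k) Hl), Nat.eqb_refl. ring.
    + intros j _ Hj. unfold binner, e. rewrite (proj2 (Nat.eqb_neq j i) Hj).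
      apply fsum_eq0; intros; ring.
  - apply fsum_le; intros j Hj. apply fsum_le; intros l Hl. unfold e.
    destruct (Nat.eqb_spec j i) as [->|]; [destruct (Nat.eqb_spec l k) as [->|]|]; nra.
Qed.

(** Moving along [mask i v] changes block i alone, so a block gradient becomes an ordinary
    directional derivative. *)
Definition mask (i : nat) (v : vec) : vec := fun j => if Nat.eqb j i then v j else fun _ => 0.

Lemma vnorm_mask i v : nrm (mask i v) <= nrm v.
Proof.
  apply vnorm_le. intros j k _ _. unfold mask. destruct (Nat.eqb j i); [lra|].
  rewrite Rabs_R0. apply Rabs_pos.
Qed.

Lemma inner_mask x i v : (i < I)%nat -> inn x (mask i v) = binner (nb i) (x i) (v i).
Proof.
  intros Hi. unfold inner. rewrite (fsum_single I i); [|exact Hi|].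
  - unfold mask. rewrite Nat.eqb_refl. reflexivity.
  - intros j _ Hj. unfold binner, mask. rewrite (proj2 (Nat.eqb_neq j i) Hj).
    apply fsum_eq0; intros; ring.
Qed.

(** The difference consists of block i of w - w' and the other blocks of y - y'; both are coordinate
    projections, hence nonexpansive. *)
Lemma vnorm_sub_upd y y' w w' i :
  nrm (vsub (upd y i (w i)) (upd y' i (w' i))) <= nrm (vsub w w') + nrm (vsub y y').
Proof.
  rewrite (vnorm_ext _ (vadd (mask i (vsub w w'))
                             (vsub (vsub y y') (mask i (vsub y y'))))).
  2: { intros j k _ _. unfold vsub, vadd, upd, mask.
       destruct (Nat.eqb_spec j i) as [->|]; ring. }
  eapply Rle_trans; [apply vnorm_vadd|]. apply Rplus_le_compat; [apply vnorm_mask|].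
  apply vnorm_le. intros j k _ _. unfold vsub, mask.
  destruct (Nat.eqb j i); [|rewrite Rminus_0_r; lra].
  rewrite Rminus_diag_eq by reflexivity. rewrite Rabs_R0. apply Rabs_pos.
Qed.

Lemma upd_same (y : vec) i : upd y i (y i) = y.
Proof.
  apply functional_extensionality; intros j. unfold upd.
  destruct (Nat.eqb_spec j i) as [->|]; reflexivity.
Qed.

(** * Compactness of bounded sequences *)

Lemma bounded_seq_subseq (u : nat -> R) B : (forall n, Rabs (u n) <= B) ->
  exists l phi, (forall n, (n <= phi n)%nat) /\ Un_cv (fun n => u (phi n)) l.
Proof.
  intros HB.
  destruct (Bolzano_Weierstrass u (fun c => - B <= c <= B) (compact_P3 (- B) B)) as [l Hl].
  { intros n. specialize (HB n). apply Rabs_le_inv in HB. lra. }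
  (* Subsequences are indexed by phi with n <= phi n, not necessarily increasing: this suffices for
     limits and lets phi be chosen pointwise. *)
  assert (H : forall n, exists p, (n <= p)%nat /\ Rabs (u p - l) < / INR (S n)).
  { intros n.
    assert (Hn : 0 < / INR (S n)) by (apply Rinv_0_lt_compat, lt_0_INR; lia).
    apply (Hl (disc l (mkposreal _ Hn)) n).
    exists (mkposreal _ Hn). intros x Hx; exact Hx. }
  apply choice in H. destruct H as [phi Hphi].
  exists l, phi. split; [intros n; apply Hphi|].
  intros e He. destruct (archimed_cor1 e He) as [N [HN HN0]].
  exists N. intros n Hn. unfold Rdist. eapply Rlt_trans; [apply Hphi|].
  eapply Rle_lt_trans; [|exact HN].
  apply Rinv_le_contravar; [apply lt_0_INR; lia|apply le_INR; lia].
Qed.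

Lemma cv_subseq (u : nat -> R) l (phi : nat -> nat) : (forall n, (n <= phi n)%nat) ->
  Un_cv u l -> Un_cv (fun n => u (phi n)) l.
Proof.
  intros Hphi Hu e He. destruct (Hu e He) as [N HN]. exists N. intros n Hn.
  apply HN. specialize (Hphi n). lia.
Qed.

(** Coordinates are treated one at a time; each further extraction preserves the limits already
    obtained. *)
Lemma bounded_coords_subseq (xs : nat -> vec) B (cs : list (nat * nat)) :
  (forall c, In c cs -> forall n, Rabs (xs n (fst c) (snd c)) <= B) ->
  exists (l : vec) phi, (forall n, (n <= phi n)%nat) /\
    forall c, In c cs -> Un_cv (fun n => xs (phi n) (fst c) (snd c)) (l (fst c) (snd c)).
Proof.
  induction cs as [|[i k] cs IH]; intros HB.
  - exists (fun _ _ => 0), (fun n => n). split; [auto|intros c []].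
  - destruct IH as (l & phi & Hphi & Hl); [intros; apply HB; simpl; auto|].
    destruct (bounded_seq_subseq (fun n => xs (phi n) i k) B) as (a & psi & Hpsi & Ha).
    { intros n. apply (HB (i, k)). left; reflexivity. }
    exists (fun j m => if Nat.eqb j i then if Nat.eqb m k then a else l j m else l j m).
    exists (fun n => phi (psi n)). split.
    { intros n. specialize (Hpsi n). specialize (Hphi (psi n)). lia. }
    intros [j m] Hc. simpl.
    destruct (Nat.eqb_spec j i) as [->|Hj]; [destruct (Nat.eqb_spec m k) as [->|Hm]|].
    + exact Ha.
    + destruct Hc as [[=]|Hc]; [congruence|].
      apply (cv_subseq (fun n => xs (phi n) i m)); [exact Hpsi|apply (Hl (i, m) Hc)].
    + destruct Hc as [[=]|Hc]; [congruence|].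
      apply (cv_subseq (fun n => xs (phi n) j m)); [exact Hpsi|apply (Hl (j, m) Hc)].
Qed.

Lemma bounded_limit_point (xs : nat -> vec) B : (forall n, nrm (xs n) <= B) ->
  exists xl, limit_point I nb xs xl.
Proof.
  intros HB.
  set (cs := flat_map (fun i => map (pair i) (seq 0 (nb i))) (seq 0 I)).
  assert (Hcs : forall i k, In (i, k) cs <-> (i < I)%nat /\ (k < nb i)%nat).
  { intros i k. unfold cs. rewrite in_flat_map. split.
    - intros (j & Hj & H). apply in_map_iff in H. destruct H as (m & [= -> ->] & Hm).
      apply in_seq in Hj, Hm. lia.
    - intros [Hi Hk]. exists i. split; [apply in_seq; lia|].
      apply in_map_iff. exists k. split; [reflexivity|apply in_seq; lia]. }
  destruct (bounded_coords_subseq xs B cs) as (l & phi & Hphi & Hl).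
  { intros [i k] Hc n. apply Hcs in Hc. eapply Rle_trans; [|apply (HB n)].
    now apply coord_le_vnorm. }
  exists l. intros e He N.
  assert (Hcv : Un_cv (fun n => inn (vsub (xs (phi n)) l) (vsub (xs (phi n)) l)) 0).
  { apply fsum_cv_zero. intros i Hi. apply fsum_cv_zero. intros k Hk.
    replace 0 with ((l i k - l i k) * (l i k - l i k)) by ring.
    assert (H : Un_cv (fun n => xs (phi n) i k - l i k) (l i k - l i k)).
    { apply CV_minus; [apply (Hl (i, k)), Hcs; auto|].
      intros e' He'. exists 0%nat. intros. unfold Rdist.
      rewrite Rminus_diag_eq by reflexivity. now rewrite Rabs_R0. }
    apply (CV_mult _ _ _ _ H H). }
  destruct (Hcv (e ^ 2) ltac:(nra)) as [M HM].
  exists (phi (max N M)). split; [specialize (Hphi (max N M)); lia|].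
  specialize (HM (max N M) ltac:(lia)). unfold Rdist in HM.
  rewrite Rminus_0_r, Rabs_right in HM by (apply Rle_ge, inner_nonneg).
  unfold vnorm. rewrite <- (sqrt_pow2 e) by lra. apply sqrt_lt_1_alt. split; [apply inner_nonneg|exact HM].
Qed.

(** * Differentiability and continuity *)

Lemma derivable_along U F G x v : has_grad_on I nb U F G -> U x ->
  derivable_pt_lim (fun t => F (vadd x (vscal t v))) 0 (inn (G x) v).
Proof.
  intros HG Ux e He. assert (Hv := vnorm_nonneg v).
  (* The summand 1 covers v = 0, and the factor 2 makes the final estimate strict. *)
  destruct (HG x Ux (e / (2 * (1 + nrm v)))) as (d & Hd & H).
  { apply Rdiv_lt_0_compat; lra. }
  assert (Hd' : 0 < d / (1 + nrm v)) by (apply Rdiv_lt_0_compat; lra).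
  exists (mkposreal _ Hd'). intros t Ht Htd. simpl in Htd.
  rewrite Rplus_0_l.
  replace (vadd x (vscal 0 v)) with x.
  2: { do 2 (apply functional_extensionality; intros). unfold vadd, vscal; ring. }
  assert (Hdiff : vsub (vadd x (vscal t v)) x = vscal t v).
  { do 2 (apply functional_extensionality; intros). unfold vsub, vadd, vscal; ring. }
  specialize (H (vadd x (vscal t v))). rewrite Hdiff, vnorm_vscal, inner_vscal_r in H.
  assert (Htp : 0 < Rabs t) by (apply Rabs_pos_lt; exact Ht).
  assert (Hlt : Rabs t * nrm v < d).
  { apply (Rmult_lt_compat_r (1 + nrm v)) in Htd; [|lra].
    replace (d / (1 + nrm v) * (1 + nrm v)) with d in Htd by (field; lra). nra. }
  specialize (H Hlt).
  replace ((F (vadd x (vscal t v)) - F x) / t - inn (G x) v)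
    with ((F (vadd x (vscal t v)) - F x - t * inn (G x) v) / t) by (field; exact Ht).
  unfold Rdiv at 1. rewrite Rabs_mult, Rabs_inv.
  apply (Rmult_lt_reg_r (Rabs t)); [exact Htp|].
  rewrite Rmult_assoc, Rinv_l, Rmult_1_r by lra.
  eapply Rle_lt_trans; [exact H|].
  replace (e / (2 * (1 + nrm v)) * (Rabs t * nrm v))
    with (e * Rabs t * (nrm v / (2 * (1 + nrm v)))) by (field; lra).
  assert (nrm v / (2 * (1 + nrm v)) < 1).
  { apply (Rmult_lt_reg_r (2 * (1 + nrm v))); [lra|]. unfold Rdiv.
    rewrite Rmult_assoc, Rinv_l by lra. lra. }
  assert (0 < e * Rabs t) by (apply Rmult_lt_0_compat; lra). nra.
Qed.

(** Here y ranges over the whole space rather than S, as differentiability on a neighbourhood of S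
    allows. *)
Definition continuous_on (S : vec -> Prop) (F : vec -> R) : Prop :=
  forall x, S x -> forall e, e > 0 -> exists d, d > 0 /\
    forall y, nrm (vsub y x) < d -> Rabs (F y - F x) < e.

Lemma C1_near_continuous S F G : C1_near I nb S F G -> continuous_on S F.
Proof.
  intros (U & _ & HSU & HG & _) x Hx e He.
  destruct (HG x (HSU x Hx) 1 ltac:(lra)) as (d & Hd & H).
  assert (Hn := vnorm_nonneg (G x)).
  assert (Hd' : 0 < e / (2 + nrm (G x))) by (apply Rdiv_lt_0_compat; lra).
  exists (Rmin d (e / (2 + nrm (G x)))). split; [now apply Rmin_pos|].
  intros y Hy. assert (Hyn := vnorm_nonneg (vsub y x)).
  assert (H1 := Rlt_le_trans _ _ _ Hy (Rmin_l _ _)).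
  assert (H2 := Rlt_le_trans _ _ _ Hy (Rmin_r _ _)).
  apply (Rmult_lt_compat_r (2 + nrm (G x))) in H2; [|lra].
  replace (e / (2 + nrm (G x)) * (2 + nrm (G x))) with e in H2 by (field; lra).
  specialize (H y H1). apply Rabs_le_inv in H.
  assert (H3 := inner_le (G x) (vsub y x)). assert (H4 := inner_ge_neg (G x) (vsub y x)).
  apply Rabs_def1; nra.
Qed.

Lemma continuous_plus S F G : continuous_on S F -> continuous_on S G ->
  continuous_on S (fun x => F x + G x).
Proof.
  intros HF HG x Hx e He.
  destruct (HF x Hx (e / 2) ltac:(lra)) as (d & Hd & H).
  destruct (HG x Hx (e / 2) ltac:(lra)) as (d' & Hd' & H').
  exists (Rmin d d'). split; [now apply Rmin_pos|]. intros y Hy.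
  specialize (H y (Rlt_le_trans _ _ _ Hy (Rmin_l _ _))).
  specialize (H' y (Rlt_le_trans _ _ _ Hy (Rmin_r _ _))).
  apply Rabs_def2 in H, H'. apply Rabs_def1; lra.
Qed.

Lemma continuous_minus S F G : continuous_on S F -> continuous_on S G ->
  continuous_on S (fun x => F x - G x).
Proof.
  intros HF HG. apply (continuous_plus S F (fun x => - G x) HF).
  intros x Hx e He. destruct (HG x Hx e He) as (d & Hd & H).
  exists d. split; [exact Hd|]. intros y Hy. specialize (H y Hy).
  apply Rabs_def2 in H. apply Rabs_def1; lra.
Qed.

Lemma continuous_fsum S m (F : nat -> vec -> R) :
  (forall i, (i < m)%nat -> continuous_on S (F i)) ->
  continuous_on S (fun x => fsum m (fun i => F i x)).
Proof.
  induction m as [|m IH]; simpl; intros H.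
  - intros x _ e He. exists 1. split; [lra|]. intros. rewrite Rminus_diag_eq by reflexivity.
    rewrite Rabs_R0; exact He.
  - apply (continuous_plus S (fun x => fsum m (fun i => F i x)) (F m));
      [apply IH; intros|]; apply H; lia.
Qed.

Lemma continuous_sqdist S K a :
  0 <= K -> continuous_on S (fun x => K * inn (vsub x a) (vsub x a)).
Proof.
  (* For |y - x| < 1 the two squared distances to a differ by at most M |y - x|. *)
  intros HK x _ e He. set (M := 1 + 2 * nrm (vsub x a)).
  assert (HM := vnorm_nonneg (vsub x a)).
  assert (HKM : 0 <= K * M) by (unfold M; nra).
  assert (Hd : 0 < e / (1 + K * M)) by (apply Rdiv_lt_0_compat; lra).
  exists (Rmin 1 (e / (1 + K * M))). split; [apply Rmin_pos; lra|]. intros y Hy.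
  assert (Hy1 := Rlt_le_trans _ _ _ Hy (Rmin_l _ _)).
  assert (Hy2 := Rlt_le_trans _ _ _ Hy (Rmin_r _ _)).
  apply (Rmult_lt_compat_r (1 + K * M)) in Hy2; [|lra].
  replace (e / (1 + K * M) * (1 + K * M)) with e in Hy2 by (field; lra).
  assert (H0 := vnorm_nonneg (vsub y x)).
  replace (K * inn (vsub y a) (vsub y a) - K * inn (vsub x a) (vsub x a))
    with (K * (inn (vsub y x) (vsub y x) + 2 * inn (vsub y x) (vsub x a))).
  2: { repeat rewrite ?inner_vsub_l, ?inner_vsub_r.
       rewrite (inner_sym y x), (inner_sym a x), (inner_sym a y). ring. }
  rewrite <- vnorm_sqr, Rabs_mult, (Rabs_right K) by lra.
  assert (H1 := inner_le (vsub y x) (vsub x a)).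
  assert (H2 := inner_ge_neg (vsub y x) (vsub x a)).
  assert (Rabs (nrm (vsub y x) ^ 2 + 2 * inn (vsub y x) (vsub x a)) <= nrm (vsub y x) * M).
  { unfold M. apply Rabs_le. nra. }
  nra.
Qed.

(** * Minimizers of coercive functions on closed sets *)

Definition vclosed (S : vec -> Prop) : Prop :=
  forall x, (forall e, e > 0 -> exists y, S y /\ nrm (vsub y x) < e) -> S x.

Lemma limit_point_mem (S : vec -> Prop) xs xl : vclosed S -> (forall n, S (xs n)) ->
  limit_point I nb xs xl -> S xl.
Proof.
  intros HS Hxs Hl. apply HS. intros e He. destruct (Hl e He 0%nat) as (n & _ & Hn).
  exists (xs n). auto.
Qed.

(** Coercivity bounds the sequence, so it clusters in S. The conclusion is the form of
    semicontinuity used twice below, for boundedness from below and for attainment. *)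
Lemma sublevel_cluster S F (w : nat -> vec) M : vclosed S -> continuous_on S F ->
  coercive_on I nb S F -> (forall n, S (w n)) -> (forall n, F (w n) <= M) ->
  exists a, S a /\ forall e N, e > 0 -> exists n, (N <= n)%nat /\ F a < F (w n) + e.
Proof.
  intros HS HF Hco Hw HM. destruct (Hco M) as [r Hr].
  destruct (bounded_limit_point w r) as [a Ha].
  { intros n. apply Rnot_lt_le. intros Hlt. specialize (Hr _ (Hw n) Hlt).
    specialize (HM n). lra. }
  assert (Sa := limit_point_mem S w a HS Hw Ha).
  exists a. split; [exact Sa|]. intros e N He.
  destruct (HF a Sa e He) as (d & Hd & H). destruct (Ha d Hd N) as (n & Hn & Hnd).
  exists n. split; [exact Hn|]. specialize (H _ Hnd). apply Rabs_def2 in H. lra.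
Qed.

Lemma coercive_minimizer S F : vclosed S -> (exists x, S x) -> continuous_on S F ->
  coercive_on I nb S F -> exists p, S p /\ forall x, S x -> F p <= F x.
Proof.
  intros HS [x0 Hx0] HF Hco.
  assert (Hbd : exists m, forall x, S x -> m <= F x).
  (* Otherwise values below -n along a sequence would force F at its cluster point below 1 - n for
     arbitrarily large n. *)
  { apply NNPP. intros Hno.
    assert (H : forall n, exists x, S x /\ F x < - INR n).
    { intros n. apply NNPP. intros Hn. apply Hno. exists (- INR n). intros x Hx.
      apply Rnot_lt_le. intros Hlt. apply Hn. exists x. auto. }
    apply choice in H. destruct H as [w Hw].
    destruct (sublevel_cluster S F w 0 HS HF Hco) as (a & _ & Ha).
    { apply Hw. } { intros n. destruct (Hw n). assert (H' := pos_INR n). lra. }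
    destruct (INR_unbounded (1 - F a)) as [N HN].
    destruct (Ha 1 N ltac:(lra)) as (n & Hn & Hlt). apply le_INR in Hn.
    destruct (Hw n). lra. }
  destruct Hbd as [m Hm].
  destruct (completeness (fun t => exists x, S x /\ t = - F x)) as [s [Hub Hlub]].
  { exists (- m). intros t (x & Hx & ->). specialize (Hm x Hx). lra. }
  { exists (- F x0), x0. auto. }
  assert (Hs : forall x, S x -> - s <= F x).
  { intros x Hx. specialize (Hub (- F x)). enough (- F x <= s) by lra.
    apply Hub. exists x. auto. }
  assert (H : forall n, exists x, S x /\ F x < - s + / INR (Datatypes.S n)).
  { intros n. apply NNPP. intros Hn.
    assert (Hp : 0 < / INR (Datatypes.S n)) by (apply Rinv_0_lt_compat, lt_0_INR; lia).
    enough (s <= s - / INR (Datatypes.S n)) by lra. apply Hlub. intros t (x & Hx & ->).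
    enough (- s + / INR (Datatypes.S n) <= F x) by lra.
    apply Rnot_lt_le. intros Hlt. apply Hn. exists x. auto. }
  apply choice in H. destruct H as [w Hw].
  destruct (sublevel_cluster S F w (- s + 1) HS HF Hco) as (a & Sa & Ha).
  { apply Hw. }
  { intros n. destruct (Hw n) as [_ H]. left. eapply Rlt_le_trans; [exact H|].
    apply Rplus_le_compat_l. rewrite <- Rinv_1. apply Rinv_le_contravar; [lra|].
    change 1 with (INR 1). apply le_INR. lia. }
  exists a. split; [exact Sa|]. intros x Hx. apply Rle_trans with (- s); [|auto].
  apply Rnot_lt_le. intros Hlt.
  (* Half of the gap between F a and the infimum -s is spent on 1/N, half on the distance to the
     cluster value. *)
  destruct (archimed_cor1 ((F a + s) / 2) ltac:(lra)) as [N [HN HN0]].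
  destruct (Ha ((F a + s) / 2) N ltac:(lra)) as (n & Hn & H).
  destruct (Hw n) as [_ Hwn].
  assert (/ INR (Datatypes.S n) <= / INR N).
  { apply Rinv_le_contravar; [apply lt_0_INR; lia|apply le_INR; lia]. }
  lra.
Qed.


(** * Inexact iteration for an abstract objective F and surrogate gradient T w y at base point y *)

Section InexactFixedPoint.
Context (Xi : vec -> Prop) (F : vec -> R) (T : vec -> vec -> vec) (c L : R).
Context (Xi_ne : exists x, Xi x).
Context (Xi_closed : vclosed Xi).
Context (Xi_convex : forall x y t, Xi x -> Xi y -> 0 <= t <= 1 ->
  Xi (vadd x (vscal t (vsub y x)))).
Context (F_cont : continuous_on Xi F) (F_coercive : coercive_on I nb Xi F).
Context (F_deriv : forall x y, Xi x -> Xi y ->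
  derivable_pt_lim (fun t => F (vadd x (vscal t (vsub y x)))) 0 (inn (T x x) (vsub y x))).
Context (c_pos : 0 < c) (L_nonneg : 0 <= L).
Context (T_mono : forall w w' y, Xi w -> Xi w' -> Xi y ->
  c * inn (vsub w w') (vsub w w') <= inn (vsub (T w y) (T w' y)) (vsub w w')).
Context (T_lip : forall w w' y y', Xi w -> Xi w' -> Xi y -> Xi y' ->
  nrm (vsub (T w y) (T w' y')) <= L * (nrm (vsub w w') + nrm (vsub y y'))).

(* The least modulus for which Young's inequality absorbs the cross term
   L |p - x| |xh - p| in [prox_aligned] and leaves c |p - x|^2. *)
Let K := L ^ 2 / (2 * c) + c.

Lemma K_pos : 0 < K.
Proof.
  unfold K. assert (0 <= L ^ 2 / (2 * c)); [|lra].
  apply Rmult_le_pos; [apply pow2_ge_0|]. left. apply Rinv_0_lt_compat. lra.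
Qed.

(** Both faces of the minimizer are recorded: its value for comparing envelopes, its first-order
    condition for [prox_aligned]. *)
Lemma prox_exists x : exists p, Xi p /\
  (forall w, Xi w -> F p + K / 2 * inn (vsub p x) (vsub p x)
                     <= F w + K / 2 * inn (vsub w x) (vsub w x)) /\
  (forall w, Xi w -> 0 <= inn (T p p) (vsub w p) + K * inn (vsub p x) (vsub w p)).
Proof.
  assert (HK := K_pos).
  destruct (coercive_minimizer Xi (fun w => F w + K / 2 * inn (vsub w x) (vsub w x)))
    as (p & Hp & Hmin); auto.
  - apply continuous_plus; [exact F_cont|apply continuous_sqdist; lra].
  - intros M. destruct (F_coercive M) as [r Hr]. exists r. intros w Hw Hn.
    specialize (Hr w Hw Hn). assert (H := inner_nonneg (vsub w x)). nra.
  - exists p. split; [exact Hp|]. split; [exact Hmin|]. intros w Hw.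
    set (b := K * inn (vsub p x) (vsub w p)).
    set (q := K / 2 * inn (vsub w p) (vsub w p)).
    apply (derivable_pt_lim_min
             (fun t => F (vadd p (vscal t (vsub w p))) + (t * b + t * t * q))).
    { apply (derivable_pt_lim_plus _ (fun t => t * b + t * t * q)); [now apply F_deriv|].
      apply derivable_pt_lim_quadratic. }
    intros t Ht. replace (vadd p (vscal 0 (vsub w p))) with p.
    2: { do 2 (apply functional_extensionality; intros). unfold vadd, vscal; ring. }
    assert (H := Hmin _ (Xi_convex p w t Hp Hw ltac:(lra))).
    set (v := vsub w p) in *.
    enough (K / 2 * inn (vsub (vadd p (vscal t v)) x) (vsub (vadd p (vscal t v)) x)
            = K / 2 * inn (vsub p x) (vsub p x) + (t * b + t * t * q)) by lra.
    unfold b, q. repeat rewrite ?inner_vsub_l, ?inner_vsub_r, ?inner_vadd_l, ?inner_vadd_r,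
      ?inner_vscal_l, ?inner_vscal_r.
    rewrite (inner_sym v p), (inner_sym v x), (inner_sym x p). field.
Qed.

(** T xh x and T p p are compared through T p x: strong monotonicity at base point x gains c |xh -
    p|^2, and changing the base point from x to p costs L |p - x| |xh - p|. *)
Lemma prox_aligned x p xh : Xi x -> Xi p -> Xi xh ->
  (forall w, Xi w -> 0 <= inn (T p p) (vsub w p) + K * inn (vsub p x) (vsub w p)) ->
  (forall w, Xi w -> 0 <= inn (T xh x) (vsub w xh)) ->
  c * inn (vsub p x) (vsub p x) + c / 2 * inn (vsub xh p) (vsub xh p)
  <= K * inn (vsub p x) (vsub xh x).
Proof.
  intros Hx Hp Hxh VIp VIxh.
  specialize (VIp xh Hxh). specialize (VIxh p Hp).
  assert (Hm := T_mono xh p x Hxh Hp Hx).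
  assert (Hl := T_lip p p x p Hp Hp Hx Hp).
  rewrite vnorm_vsub_self, Rplus_0_l, vnorm_vsub_sym in Hl.
  rewrite (vnorm_vsub_sym x p) in Hl.
  assert (Hcs := inner_ge_neg (vsub (T p x) (T p p)) (vsub xh p)).
  assert (Hq := vnorm_nonneg (vsub p x)). assert (Hd := vnorm_nonneg (vsub xh p)).
  rewrite <- !vnorm_sqr in *.
  rewrite (vnorm_vsub_sym (T p p)) in Hl.
  set (Q := nrm (vsub p x)) in *. set (D := nrm (vsub xh p)) in *.
  assert (Hcs' : nrm (vsub (T p x) (T p p)) * D <= L * Q * D)
    by (apply Rmult_le_compat_r; assumption).
  assert (Hsplit : inn (vsub p x) (vsub xh x) = inn (vsub p x) (vsub xh p) + Q ^ 2).
  { unfold Q. rewrite vnorm_sqr. repeat rewrite ?inner_vsub_l, ?inner_vsub_r. ring. }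
  rewrite Hsplit.
  assert (Hamgm : L * Q * D <= L ^ 2 / (2 * c) * Q ^ 2 + c / 2 * D ^ 2).
  { apply Rminus_le.
    replace (L * Q * D - (L ^ 2 / (2 * c) * Q ^ 2 + c / 2 * D ^ 2))
      with (- ((L * Q - c * D) ^ 2 * / (2 * c))) by (field; lra).
    assert (0 <= (L * Q - c * D) ^ 2 * / (2 * c)); [|lra].
    apply Rmult_le_pos; [apply pow2_ge_0|]. left. apply Rinv_0_lt_compat. lra. }
  assert (HK : K * Q ^ 2 = L ^ 2 / (2 * c) * Q ^ 2 + c * Q ^ 2) by (unfold K; ring).
  rewrite !inner_vsub_l, !(inner_vsub_r _ _ (T _ _)) in *.
  lra.
Qed.

(** Test each variational inequality at the other solution and pass through T w' y: strong
    monotonicity at y is weighed against the Lipschitz change of base point. *)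
Lemma best_response_lipschitz y y' w w' : Xi y -> Xi y' -> Xi w -> Xi w' ->
  (forall v, Xi v -> 0 <= inn (T w y) (vsub v w)) ->
  (forall v, Xi v -> 0 <= inn (T w' y') (vsub v w')) ->
  nrm (vsub w' w) <= L / c * nrm (vsub y' y).
Proof.
  intros Hy Hy' Hw Hw' VI VI'. specialize (VI w' Hw'). specialize (VI' w Hw).
  assert (Hm := T_mono w' w y Hw' Hw Hy).
  assert (Hl := T_lip w' w' y y' Hw' Hw' Hy Hy').
  rewrite vnorm_vsub_self, Rplus_0_l, (vnorm_vsub_sym y y') in Hl.
  assert (Hcs := inner_le (vsub (T w' y) (T w' y')) (vsub w' w)).
  assert (Hd := vnorm_nonneg (vsub w' w)).
  rewrite <- vnorm_sqr in Hm.
  set (D := nrm (vsub w' w)) in *.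
  assert (H : c * D ^ 2 <= L * nrm (vsub y' y) * D).
  { apply Rle_trans with (nrm (vsub (T w' y) (T w' y')) * D).
    - rewrite !inner_vsub_l, !inner_vsub_r in *. lra.
    - now apply Rmult_le_compat_r. }
  apply (Rmult_le_reg_l c); [lra|].
  replace (c * (L / c * nrm (vsub y' y))) with (L * nrm (vsub y' y)) by (field; lra).
  destruct (Rle_lt_or_eq_dec _ _ Hd) as [HD|HD].
  - apply (Rmult_le_reg_r D); [lra|]. nra.
  - rewrite <- HD, Rmult_0_r. apply Rmult_le_pos; [lra|apply vnorm_nonneg].
Qed.

Lemma stationary_of_approx a :
  Xi a ->
  (forall e, 0 < e -> exists y w, Xi y /\ Xi w /\ nrm (vsub y a) < e /\ nrm (vsub w y) < e /\
     forall v, Xi v -> 0 <= inn (T w y) (vsub v w)) ->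
  forall v, Xi v -> 0 <= inn (T a a) (vsub v a).
Proof.
  intros Ha H v Hv. apply Rnot_lt_le. intros Hneg.
  (* With y within e of a and w within 2 e, T changes by at most 3 L e. The first term of M is this
     change tested on v - a; the second moves w to a, with |T w y| <= |T a a| + 3 L because e <=
     1. *)
  set (M := 3 * L * nrm (vsub v a) + 2 * (nrm (T a a) + 3 * L)).
  assert (H1 := vnorm_nonneg (vsub v a)). assert (H2 := vnorm_nonneg (T a a)).
  assert (HM : 0 <= M) by (unfold M; nra).
  set (s := - inn (T a a) (vsub v a)) in *. assert (Hs : 0 < s) by (unfold s; lra).
  destruct (H (Rmin 1 (s / (1 + M)))) as (y & w & Hy & Hw & Hya & Hwy & VI).
  { apply Rmin_pos; [lra|]. apply Rdiv_lt_0_compat; lra. }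
  assert (He1 := Rmin_l 1 (s / (1 + M))). assert (He2 := Rmin_r 1 (s / (1 + M))).
  set (e := Rmin 1 (s / (1 + M))) in *.
  assert (HeM : e * (1 + M) <= s).
  { replace s with (s / (1 + M) * (1 + M)) by (field; lra). apply Rmult_le_compat_r; lra. }
  specialize (VI v Hv).
  assert (Hwa : nrm (vsub w a) <= 2 * e).
  { eapply Rle_trans; [apply (vnorm_vsub_triangle y)|]. lra. }
  assert (Hl := T_lip w a y a Hw Ha Hy Ha).
  assert (Hl' : nrm (vsub (T w y) (T a a)) <= 3 * L * e).
  { eapply Rle_trans; [exact Hl|]. nra. }
  assert (Hc1 := inner_le (vsub (T w y) (T a a)) (vsub v a)).
  assert (Hc2 := inner_ge_neg (T w y) (vsub w a)).
  assert (Hn : nrm (T w y) <= nrm (T a a) + 3 * L).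
  { rewrite (vnorm_ext (T w y) (vadd (T a a) (vsub (T w y) (T a a))))
      by (intros; unfold vadd, vsub; ring).
    eapply Rle_trans; [apply vnorm_vadd|]. nra. }
  assert (H3 := vnorm_nonneg (T w y)). assert (H4 := vnorm_nonneg (vsub w a)).
  assert (Hp1 : nrm (vsub (T w y) (T a a)) * nrm (vsub v a) <= 3 * L * e * nrm (vsub v a))
    by now apply Rmult_le_compat_r.
  assert (Hp2 : nrm (T w y) * nrm (vsub w a) <= (nrm (T a a) + 3 * L) * (2 * e))
    by now apply Rmult_le_compat.
  assert (Hid : inn (T w y) (vsub v w)
                = inn (vsub (T w y) (T a a)) (vsub v a) - s - inn (T w y) (vsub w a)).
  { unfold s. rewrite !inner_vsub_l, !inner_vsub_r. ring. }
  assert (e * (1 + M) = e + 3 * L * e * nrm (vsub v a) + (nrm (T a a) + 3 * L) * (2 * e))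
    by (unfold M; ring).
  assert (0 < e) by (unfold e; apply Rmin_pos; [lra|apply Rdiv_lt_0_compat; lra]).
  lra.
Qed.

(* The old proximal point p is a competitor for the envelope at x', so no descent lemma for F
   and no bound on its gradient are needed. *)
Lemma moreau_descent x p p' xh z g e :
  Xi x -> Xi p -> Xi xh -> 0 < g -> K * g <= c / 8 -> nrm (vsub z xh) <= e ->
  (forall w, Xi w -> 0 <= inn (T p p) (vsub w p) + K * inn (vsub p x) (vsub w p)) ->
  (forall w, Xi w -> 0 <= inn (T xh x) (vsub w xh)) ->
  let x' := vadd x (vscal g (vsub z x)) in
  (forall w, Xi w -> F p' + K / 2 * inn (vsub p' x') (vsub p' x')
                     <= F w + K / 2 * inn (vsub w x') (vsub w x')) ->
  F p' + K / 2 * inn (vsub p' x') (vsub p' x')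
  <= F p + K / 2 * inn (vsub p x) (vsub p x)
     - g * (c / 8 * nrm (vsub xh x) ^ 2) + g * ((K ^ 2 / (2 * c) + c / 8) * e ^ 2).
Proof.
  intros Hx Hp Hxh Hg HKg He VIp VIxh x' Hmin.
  eapply Rle_trans; [apply (Hmin p Hp)|].
  assert (HK := K_pos).
  assert (Hal := prox_aligned x p xh Hx Hp Hxh VIp VIxh).
  assert (Hexp : inn (vsub p x') (vsub p x')
    = inn (vsub p x) (vsub p x)
      - 2 * g * (inn (vsub p x) (vsub xh x) + inn (vsub p x) (vsub z xh))
      + g ^ 2 * inn (vsub z x) (vsub z x)).
  { unfold x'. repeat rewrite ?inner_vsub_l, ?inner_vsub_r, ?inner_vadd_l, ?inner_vadd_r,
      ?inner_vscal_l, ?inner_vscal_r.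
    rewrite (inner_sym x p), (inner_sym z p), (inner_sym z x). ring. }
  rewrite Hexp.
  assert (Hcs := inner_ge_neg (vsub p x) (vsub z xh)).
  assert (Hzx := vnorm_vsub_triangle xh z x).
  assert (Hux := vnorm_vsub_triangle p xh x).
  rewrite <- !vnorm_sqr in *.
  assert (H1 := vnorm_nonneg (vsub p x)). assert (H2 := vnorm_nonneg (vsub xh p)).
  assert (H3 := vnorm_nonneg (vsub z xh)). assert (H4 := vnorm_nonneg (vsub xh x)).
  assert (H5 := vnorm_nonneg (vsub z x)).
  set (Q := nrm (vsub p x)) in *. set (D := nrm (vsub xh p)) in *.
  set (U := nrm (vsub xh x)) in *. set (Z := nrm (vsub z x)) in *.
  set (qu := inn (vsub p x) (vsub xh x)) in *. set (qe := inn (vsub p x) (vsub z xh)) in *.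
  set (E := nrm (vsub z xh)) in *.
  assert (Hqe : - (Q * e) <= qe).
  { assert (Q * E <= Q * e) by now apply Rmult_le_compat_l. lra. }
  assert (HZ : Z ^ 2 <= 2 * U ^ 2 + 2 * e ^ 2) by (apply sqr_le_double; lra).
  assert (HU : U ^ 2 <= 2 * Q ^ 2 + 2 * D ^ 2) by (apply sqr_le_double; lra).
  assert (Hamgm : K * (Q * e) <= c / 2 * Q ^ 2 + K ^ 2 / (2 * c) * e ^ 2).
  { apply Rminus_le.
    replace (K * (Q * e) - (c / 2 * Q ^ 2 + K ^ 2 / (2 * c) * e ^ 2))
      with (- ((c * Q - K * e) ^ 2 * / (2 * c))) by (field; lra).
    assert (0 <= (c * Q - K * e) ^ 2 * / (2 * c)); [|lra].
    apply Rmult_le_pos; [apply pow2_ge_0|]. left. apply Rinv_0_lt_compat. lra. }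
  (* Half of c Q^2 absorbs the error term K Q e; the other half together with c/2 D^2 dominates c/4
     U^2. *)
  assert (Hd : c / 4 * U ^ 2 - K ^ 2 / (2 * c) * e ^ 2 <= K * (qu + qe)) by nra.
  (* The second-order term may consume half of the gain c/4 U^2, whence the threshold K g <= c/8 and
     the remaining c/8. *)
  assert (Hq2 : K / 2 * (g ^ 2 * Z ^ 2) <= g * (c / 8 * (U ^ 2 + e ^ 2))).
  { replace (K / 2 * (g ^ 2 * Z ^ 2)) with (g * (K * g * (Z ^ 2 / 2))) by field.
    apply Rmult_le_compat_l; [lra|]. apply Rmult_le_compat; nra. }
  apply (Rmult_le_compat_l g) in Hd; [|lra]. nra.
Qed.

(** * Boundedness, vanishing residual and limit points *)

Section Iteration.
Context (x z xh : nat -> vec) (gam eps : nat -> R).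
Context (Hx0 : Xi (x 0%nat)) (Hz : forall n, Xi (z n)).
Context (Hxh : forall n, Xi (xh n)).
Context (VIxh : forall n w, Xi w -> 0 <= inn (T (xh n) (x n)) (vsub w (xh n))).
Context (Hzxh : forall n, nrm (vsub (z n) (xh n)) <= eps n).
Context (Hx : forall n, x (S n) = vadd (x n) (vscal (gam n) (vsub (z n) (x n)))).
Context (Hgam : forall n, 0 < gam n <= 1) (Hgam0 : Un_cv gam 0).
Context (Hgam_div : series_diverges gam).
Context (B0 : R) (Heps2 : forall n, fsum n (fun k => gam k * eps k ^ 2) <= B0).

Lemma iterate_mem n : Xi (x n).
Proof.
  induction n as [|n IH]; [exact Hx0|]. rewrite Hx. apply Xi_convex; auto.
  assert (Hgn := Hgam n). lra.
Qed.

Lemma eps_nonneg n : 0 <= eps n.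
Proof. eapply Rle_trans; [apply vnorm_nonneg|apply Hzxh]. Qed.

Lemma iterate_bounds : exists N B, (forall n, (N <= n)%nat -> nrm (x n) <= B) /\
  (forall n, fsum n (fun k => gam k * nrm (vsub (xh k) (x k)) ^ 2) <= B).
Proof.
  assert (HK := K_pos).
  destruct (choice _ (fun n => prox_exists (x n))) as [p Hp].
  destruct (coercive_minimizer Xi F) as (p0 & Hp0 & Hmin0); auto.
  set (a := fun n => F (p n) + K / 2 * inn (vsub (p n) (x n)) (vsub (p n) (x n))).
  set (b := fun n => gam n * (c / 8 * nrm (vsub (xh n) (x n)) ^ 2)).
  set (C := K ^ 2 / (2 * c) + c / 8).
  assert (HC : 0 <= C).
  { unfold C. assert (0 <= K ^ 2 / (2 * c)); [|lra].
    apply Rmult_le_pos; [apply pow2_ge_0|]. left. apply Rinv_0_lt_compat. lra. }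
  set (s := fun n => C * (gam n * eps n ^ 2)).
  assert (Hc8 : 0 < c / 8 / K) by (apply Rdiv_lt_0_compat; lra).
  destruct (Hgam0 _ Hc8) as [N HN].
  destruct (almost_decreasing a b s (F p0) (C * B0) N) as (B & HaB & HbB).
  - intros n. unfold a. destruct (Hp n) as [Hpn _].
    assert (H := inner_nonneg (vsub (p n) (x n))). specialize (Hmin0 _ Hpn).
    assert (0 <= K / 2 * inn (vsub (p n) (x n)) (vsub (p n) (x n)))
      by (apply Rmult_le_pos; lra). lra.
  - intros n. unfold b. assert (Hgn := Hgam n).
    do 2 (apply Rmult_le_pos; [lra|]). apply pow2_ge_0.
  - intros n. unfold s. assert (Hgn := Hgam n).
    do 2 (apply Rmult_le_pos; [lra|]). apply pow2_ge_0.
  - intros n. unfold s. rewrite fsum_scal. now apply Rmult_le_compat_l.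
  - intros n Hn. unfold a, b, s. destruct (Hp n) as (Hpn & _ & VIp).
    destruct (Hp (S n)) as (_ & HpS & _). assert (Hgn := Hgam n).
    replace (C * (gam n * eps n ^ 2)) with (gam n * (C * eps n ^ 2)) by ring.
    rewrite Hx in HpS |- *.
    apply moreau_descent;
      [apply iterate_mem|exact Hpn|apply Hxh|lra| |apply Hzxh|exact VIp|apply VIxh|exact HpS].
    specialize (HN n Hn). unfold Rdist in HN. rewrite Rminus_0_r, Rabs_right in HN by lra.
    apply (Rmult_lt_compat_l K) in HN; [|lra].
    replace (K * (c / 8 / K)) with (c / 8) in HN by (field; lra). lra.
  - destruct (F_coercive B) as [r Hr].
    (* The envelope bound gives |p n| <= r by coercivity and Q^2 <= 2/K (B - F p0) for Q = |p n - x
       n|; then Q <= 1 + Q^2. The factor 8/c undoes the weight c/8 in [b]. *)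
    exists N, (Rmax (r + (1 + 2 / K * (B - F p0))) (8 / c * B)). split.
    + intros n Hn. apply Rle_trans with (2 := Rmax_l _ _).
      specialize (HaB n Hn). unfold a in HaB. destruct (Hp n) as (Hpn & _ & _).
      assert (H := Hmin0 _ Hpn). assert (H0 := vnorm_nonneg (vsub (p n) (x n))).
      rewrite <- vnorm_sqr in HaB.
      assert (Hpr : nrm (p n) <= r).
      { apply Rnot_lt_le. intros Hlt. specialize (Hr _ Hpn Hlt).
        assert (0 <= K / 2 * nrm (vsub (p n) (x n)) ^ 2)
          by (apply Rmult_le_pos; [lra|apply pow2_ge_0]). lra. }
      set (Q := nrm (vsub (p n) (x n))) in *.
      assert (HQ : Q ^ 2 <= 2 / K * (B - F p0)).
      { apply (Rmult_le_reg_l (K / 2)); [lra|].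
        replace (K / 2 * (2 / K * (B - F p0))) with (B - F p0) by (field; lra). lra. }
      assert (HQ1 : Q <= 1 + 2 / K * (B - F p0)) by nra.
      apply Rle_trans with (nrm (p n) + Q); [|lra].
      rewrite (vnorm_ext (x n) (vadd (p n) (vsub (x n) (p n))))
        by (intros; unfold vadd, vsub; ring).
      unfold Q. rewrite vnorm_vsub_sym. apply vnorm_vadd.
    + intros n. apply Rle_trans with (2 := Rmax_r _ _).
      specialize (HbB n). unfold b in HbB.
      rewrite (fsum_ext n _ (fun k => c / 8 * (gam k * nrm (vsub (xh k) (x k)) ^ 2))),
        fsum_scal in HbB by (intros; ring).
      apply (Rmult_le_reg_l (c / 8)); [lra|].
      replace (c / 8 * (8 / c * B)) with B by (field; lra). exact HbB.
Qed.

(* The squared residual increases by a summable amount at each step, so it converges;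
   this replaces the usual upcrossing argument. *)
Lemma residual_cv_zero : Un_cv (fun n => nrm (vsub (xh n) (x n)) ^ 2) 0.
Proof.
  destruct iterate_bounds as (_ & B & _ & HB).
  (* A step of x changes the residual by at most C times its length: 1 for the move of x, L / c for
     that of xh. *)
  set (C := 1 + L / c).
  assert (HC : 1 <= C).
  { unfold C. assert (0 <= L / c); [|lra]. apply Rmult_le_pos; [lra|].
    left. now apply Rinv_0_lt_compat. }
  set (U := fun n => nrm (vsub (xh n) (x n))) in *.
  set (A := 5 * C ^ 2).
  set (s := fun n => A * (gam n * U n ^ 2 + gam n * eps n ^ 2)).
  apply (weighted_summable_cv_zero _ s gam (Rmax B (A * (B + B0)))).
  - intros n. apply pow2_ge_0.
  - intros n. unfold s, A. assert (Hgn := Hgam n). apply Rmult_le_pos; [assert (H := pow2_ge_0 C); lra|].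
    apply Rplus_le_le_0_compat; (apply Rmult_le_pos; [lra|apply pow2_ge_0]).
  - intros n. assert (Hgn := Hgam n). lra.
  - intros n. unfold s.
    assert (HU : U (S n) <= U n + C * (gam n * (U n + eps n))).
    { unfold U.
      assert (Hlip := best_response_lipschitz (x n) (x (S n)) (xh n) (xh (S n))
        (iterate_mem n) (iterate_mem (S n)) (Hxh n) (Hxh (S n)) (VIxh n) (VIxh (S n))).
      assert (Hstep : nrm (vsub (x (S n)) (x n)) <= gam n * (U n + eps n)).
      { rewrite (vnorm_ext _ (vscal (gam n) (vsub (z n) (x n)))).
        2: { intros. rewrite Hx. unfold vsub, vadd, vscal. ring. }
        assert (Hgn := Hgam n). rewrite vnorm_vscal, Rabs_right by lra.
        apply Rmult_le_compat_l; [lra|].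
        eapply Rle_trans; [apply (vnorm_vsub_triangle (xh n))|].
        specialize (Hzxh n). unfold U. lra. }
      assert (Ht1 := vnorm_vsub_triangle (xh n) (xh (S n)) (x (S n))).
      assert (Ht2 := vnorm_vsub_triangle (x n) (xh n) (x (S n))).
      rewrite (vnorm_vsub_sym (x n) (x (S n))) in Ht2.
      fold (U n) in Ht2 |- *.
      apply (Rmult_le_compat_l C) in Hstep; [|lra]. unfold C in *. lra. }
    assert (H0 : 0 <= U (S n)) by apply vnorm_nonneg.
    assert (H1 : 0 <= U n) by apply vnorm_nonneg.
    assert (H2 := eps_nonneg n). assert (Hgn := Hgam n).
    apply (sqr_le_perturbed (U n) (U (S n)) (eps n) (gam n) C); lra.
  - intros n. unfold s. rewrite fsum_scal, fsum_plus.
    apply Rle_trans with (2 := Rmax_r _ _).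
    apply Rmult_le_compat_l; [unfold A; assert (H := pow2_ge_0 C); lra|]. specialize (HB n). specialize (Heps2 n).
    unfold U. lra.
  - intros n. eapply Rle_trans; [apply HB|apply Rmax_l].
  - exact Hgam_div.
Qed.

Lemma limit_points_stationary : (exists xl, limit_point I nb x xl) /\
  forall xl, limit_point I nb x xl ->
    Xi xl /\ forall v, Xi v -> 0 <= inn (T xl xl) (vsub v xl).
Proof.
  split.
  - destruct iterate_bounds as (N & B & HB & _).
    (* The bound holds only from N on, so the limit point is taken along the tail. *)
    destruct (bounded_limit_point (fun n => x (N + n)%nat) B) as [xl Hxl].
    { intros n. apply HB. lia. }
    exists xl. intros e He M. destruct (Hxl e He M) as (n & Hn & H).
    exists (N + n)%nat. split; [lia|exact H].
  - intros xl Hxl.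
    assert (Ha : Xi xl) by (apply (limit_point_mem Xi x); auto using iterate_mem).
    split; [exact Ha|]. apply stationary_of_approx; [exact Ha|]. intros e He.
    destruct (residual_cv_zero (e ^ 2) ltac:(nra)) as [N HN].
    destruct (Hxl e He N) as (n & Hn & H). specialize (HN n Hn).
    unfold Rdist in HN. rewrite Rminus_0_r in HN.
    assert (H0 := vnorm_nonneg (vsub (xh n) (x n))).
    rewrite Rabs_right in HN by nra.
    exists (x n), (xh n). repeat split; auto using iterate_mem. nra.
Qed.

End Iteration.
End InexactFixedPoint.
End EuclideanBlocks.

(** * Inner products of single blocks *)

Lemma binner_sym d u v : binner d u v = binner d v u.
Proof. apply fsum_ext; intros. ring. Qed.

Lemma binner_plus_l d u v w : binner d (fun k => u k + v k) w = binner d u w + binner d v w.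
Proof. unfold binner. rewrite <- fsum_plus. apply fsum_ext; intros. ring. Qed.

Lemma binner_minus_l d u v w : binner d (fun k => u k - v k) w = binner d u w - binner d v w.
Proof. unfold binner. rewrite <- fsum_minus. apply fsum_ext; intros. ring. Qed.

Lemma binner_scal_l d a u w : binner d (fun k => a * u k) w = a * binner d u w.
Proof. unfold binner. rewrite <- fsum_scal. apply fsum_ext; intros. ring. Qed.

Lemma binner_fsum_l d m (u : nat -> bvec) w :
  binner d (fun k => fsum m (fun j => u j k)) w = fsum m (fun j => binner d (u j) w).
Proof.
  unfold binner. rewrite <- fsum_swap. apply fsum_ext; intros k _.
  rewrite Rmult_comm, <- fsum_scal. apply fsum_ext; intros. ring.
Qed.

Lemma bnorm_sqr d u : bnorm d u ^ 2 = binner d u u.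
Proof.
  unfold bnorm. rewrite <- Rsqr_pow2. apply Rsqr_sqrt, fsum_nonneg. intros. nra.
Qed.

Lemma fsum_remove m i a : (i < m)%nat ->
  fsum m (fun j => if Nat.eqb j i then 0 else a j) = fsum m a - a i.
Proof.
  intros Hi.
  rewrite (fsum_ext m _ (fun j => a j - (if Nat.eqb j i then a j else 0)))
    by (intros; destruct Nat.eqb; ring).
  rewrite fsum_minus, (fsum_single m i (fun j => if Nat.eqb j i then a j else 0) Hi).
  - now rewrite Nat.eqb_refl.
  - intros j _ Hj. now rewrite (proj2 (Nat.eqb_neq j i) Hj).
Qed.

(** * Calculus of jointly Lipschitz maps *)

Section BlockLipschitz.
Context (I : nat) (nb : nat -> nat) (S : vec -> Prop).
Local Notation nrm := (vnorm I nb).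

(** Nonnegativity of L is built in so that constants combine under sums and scalings; [lipschitz_on]
    does not provide it, hence the [Rmax 0 L] in [lipschitz2_comp]. *)
Definition lipschitz2_on (F : vec -> vec -> vec) : Prop :=
  exists L, 0 <= L /\ forall w w' y y', S w -> S w' -> S y -> S y' ->
    nrm (vsub (F w y) (F w' y')) <= L * (nrm (vsub w w') + nrm (vsub y y')).

Lemma lipschitz2_ext F G :
  (forall w y i k, (i < I)%nat -> F w y i k = G w y i k) ->
  lipschitz2_on F -> lipschitz2_on G.
Proof.
  intros HFG (L & HL & H). exists L. split; [exact HL|]. intros w w' y y' Hw Hw' Hy Hy'.
  rewrite (vnorm_ext I nb _ (vsub (F w y) (F w' y'))).
  - now apply H.
  - intros i k Hi _. unfold vsub. now rewrite !HFG.
Qed.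

Lemma lipschitz2_vadd F G : lipschitz2_on F -> lipschitz2_on G ->
  lipschitz2_on (fun w y => vadd (F w y) (G w y)).
Proof.
  intros (L & HL & H) (L' & HL' & H'). exists (L + L'). split; [lra|].
  intros w w' y y' Hw Hw' Hy Hy'.
  rewrite (vnorm_ext I nb _ (vadd (vsub (F w y) (F w' y')) (vsub (G w y) (G w' y'))))
    by (intros; unfold vadd, vsub; ring).
  eapply Rle_trans; [apply vnorm_vadd|]. rewrite Rmult_plus_distr_r.
  apply Rplus_le_compat; auto.
Qed.

Lemma lipschitz2_vscal a F : lipschitz2_on F -> lipschitz2_on (fun w y => vscal a (F w y)).
Proof.
  intros (L & HL & H). assert (Ha := Rabs_pos a). exists (Rabs a * L). split; [nra|].
  intros w w' y y' Hw Hw' Hy Hy'.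
  rewrite (vnorm_ext I nb _ (vscal a (vsub (F w y) (F w' y'))))
    by (intros; unfold vscal, vsub; ring).
  rewrite vnorm_vscal, Rmult_assoc. apply Rmult_le_compat_l; auto.
Qed.

Lemma lipschitz2_vsub F G : lipschitz2_on F -> lipschitz2_on G ->
  lipschitz2_on (fun w y => vsub (F w y) (G w y)).
Proof.
  intros HF HG.
  apply (lipschitz2_ext (fun w y => vadd (F w y) (vscal (-1) (G w y)))).
  - intros. unfold vadd, vscal, vsub. ring.
  - apply lipschitz2_vadd; [exact HF|now apply lipschitz2_vscal].
Qed.

Lemma lipschitz2_fsum m (F : nat -> vec -> vec -> vec) :
  (forall j, (j < m)%nat -> lipschitz2_on (F j)) ->
  lipschitz2_on (fun w y i k => fsum m (fun j => F j w y i k)).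
Proof.
  induction m as [|m IH]; simpl; intros H.
  - exists 0. split; [lra|]. intros.
    rewrite (vnorm_ext I nb _ (vscal 0 w)) by (intros; unfold vsub, vscal; ring).
    rewrite vnorm_vscal, Rabs_R0. lra.
  - apply (lipschitz2_vadd (fun w y i k => fsum m (fun j => F j w y i k)) (F m));
      [apply IH; intros|]; apply H; lia.
Qed.

Lemma lipschitz2_mask i F : lipschitz2_on F -> lipschitz2_on (fun w y => mask i (F w y)).
Proof.
  intros (L & HL & H). exists L. split; [exact HL|]. intros w w' y y' Hw Hw' Hy Hy'.
  rewrite (vnorm_ext I nb _ (mask i (vsub (F w y) (F w' y')))).
  - eapply Rle_trans; [apply vnorm_mask|]. now apply H.
  - intros j k _ _. unfold vsub, mask. destruct (Nat.eqb j i); ring.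
Qed.

Lemma lipschitz2_comp G (phi : vec -> vec -> vec) : lipschitz_on I nb S G ->
  (forall w y, S w -> S y -> S (phi w y)) ->
  (forall w w' y y',
     nrm (vsub (phi w y) (phi w' y')) <= nrm (vsub w w') + nrm (vsub y y')) ->
  lipschitz2_on (fun w y => G (phi w y)).
Proof.
  intros [L HL] HS Hphi. exists (Rmax 0 L). split; [apply Rmax_l|].
  intros w w' y y' Hw Hw' Hy Hy'. eapply Rle_trans; [apply HL; now apply HS|].
  apply Rle_trans with (Rmax 0 L * nrm (vsub (phi w y) (phi w' y'))).
  - apply Rmult_le_compat_r; [apply vnorm_nonneg|apply Rmax_r].
  - apply Rmult_le_compat_l; [apply Rmax_l|apply Hphi].
Qed.

Lemma lipschitz2_fst : lipschitz2_on (fun w _ => w).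
Proof.
  exists 1. split; [lra|]. intros. assert (H3 := vnorm_nonneg I nb (vsub y y')). lra.
Qed.

Lemma lipschitz2_snd : lipschitz2_on (fun _ y => y).
Proof.
  exists 1. split; [lra|]. intros. assert (H3 := vnorm_nonneg I nb (vsub w w')). lra.
Qed.

End BlockLipschitz.

Lemma gradient_inequality I nb S F G x y : convex_on S F -> C1_near I nb S F G ->
  S x -> S y -> inner I nb (G x) (vsub y x) <= F y - F x.
Proof.
  intros Hc (U & _ & HSU & HG & _) Sx Sy.
  apply (derivable_pt_lim_le (fun t => F (vadd x (vscal t (vsub y x))))).
  - apply (derivable_along I nb U); auto.
  - intros t Ht.
    replace (vadd x (vscal 0 (vsub y x))) with x.
    2: { do 2 (apply functional_extensionality; intros). unfold vadd, vscal; ring. }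
    replace (vadd x (vscal t (vsub y x))) with (vadd (vscal t y) (vscal (1 - t) x)).
    2: { do 2 (apply functional_extensionality; intros). unfold vadd, vscal, vsub; ring. }
    specialize (Hc y x t Sy Sx ltac:(lra)). lra.
Qed.

(** * The surrogate of (DC) and its gradient *)

Section BlockDC.
Context (I : nat) (nb : nat -> nat) (Xs : nat -> bvec -> Prop).
Context (f g : nat -> vec -> R) (gf gg : nat -> vec -> vec) (tau : nat -> R).
Context (f_convex : forall i, (i < I)%nat -> convex_on (inX I Xs) (f i)).
Context (f_C1 : forall i, (i < I)%nat -> C1_near I nb (inX I Xs) (f i) (gf i)).
Local Notation X := (inX I Xs).
Local Notation inn := (inner I nb).

Lemma upd_mem y i u : X y -> Xs i u -> X (upd y i u).
Proof.
  intros Hy Hu j Hj. unfold upd. destruct (Nat.eqb_spec j i) as [->|]; auto.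
Qed.

(** Add the gradient inequalities at the two points; they differ in block i only, so only that block
    of the gradients survives. *)
Lemma block_gradient_monotone i x u v : (i < I)%nat -> X x -> Xs i u -> Xs i v ->
  0 <= binner (nb i) (bsub u v) (bsub (gf i (upd x i u) i) (gf i (upd x i v) i)).
Proof.
  intros Hi Hx Hu Hv.
  assert (Hxu := upd_mem x i u Hx Hu). assert (Hxv := upd_mem x i v Hx Hv).
  assert (H1 := gradient_inequality I nb X _ _ _ _ (f_convex i Hi) (f_C1 i Hi) Hxu Hxv).
  assert (H2 := gradient_inequality I nb X _ _ _ _ (f_convex i Hi) (f_C1 i Hi) Hxv Hxu).
  set (d := mask i (fun _ => bsub u v)).
  assert (E1 : inn (gf i (upd x i u)) (vsub (upd x i v) (upd x i u))
               = - inn (gf i (upd x i u)) d).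
  { replace (- inn (gf i (upd x i u)) d) with (-1 * inn (gf i (upd x i u)) d) by ring.
    rewrite <- inner_vscal_r. apply inner_ext. intros j k _ _. split; [reflexivity|].
    unfold d, vsub, vscal, upd, mask, bsub. destruct (Nat.eqb j i); ring. }
  assert (E2 : inn (gf i (upd x i v)) (vsub (upd x i u) (upd x i v))
               = inn (gf i (upd x i v)) d).
  { apply inner_ext. intros j k _ _. split; [reflexivity|].
    unfold d, vsub, upd, mask, bsub. destruct (Nat.eqb j i); ring. }
  unfold d in *. rewrite inner_mask in E1, E2 by exact Hi.
  rewrite binner_sym. unfold bsub at 1. rewrite binner_minus_l. lra.
Qed.

(* When u and v are at distance 0 no quotient bounds the admissible constants, hence the
   separate appeal to monotonicity. *)
Lemma cf_ge_strongly_monotone i x d u v : (i < I)%nat -> X x -> Xs i u -> Xs i v ->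
  cf_ge nb Xs gf i x d ->
  d * binner (nb i) (bsub u v) (bsub u v)
  <= binner (nb i) (bsub u v) (bsub (gf i (upd x i u) i) (gf i (upd x i v) i)).
Proof.
  intros Hi Hx Hu Hv Hd.
  assert (Hm := block_gradient_monotone i x u v Hi Hx Hu Hv).
  set (a := binner (nb i) (bsub u v) (bsub (gf i (upd x i u) i) (gf i (upd x i v) i))) in *.
  assert (HN : 0 <= binner (nb i) (bsub u v) (bsub u v))
    by (apply fsum_nonneg; intros; nra).
  set (N := binner (nb i) (bsub u v) (bsub u v)) in *.
  destruct (Rle_lt_or_eq_dec _ _ HN) as [HN'|<-]; [|lra].
  (* Here N > 0 bounds the admissible constants by a / N, and monotonicity makes 0 admissible, so a
     finite least upper bound exists and [cf_ge] can be applied to it. *)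
  destruct (completeness (cf_valid nb Xs gf i x)) as [m Hlub].
  - exists (a / N). intros c [_ Hc]. specialize (Hc u v Hu Hv).
    rewrite bnorm_sqr in Hc. fold N a in Hc.
    apply (Rmult_le_reg_r N); [exact HN'|]. unfold Rdiv.
    rewrite Rmult_assoc, Rinv_l by lra. lra.
  - exists 0. split; [lra|]. intros zi wi Hzi Hwi.
    assert (H := block_gradient_monotone i x zi wi Hi Hx Hzi Hwi). lra.
  - assert (Hdm := Hd m Hlub). destruct Hlub as [_ Hlub].
    assert (Hma : m <= a / N).
    { apply Hlub. intros c [_ Hc]. specialize (Hc u v Hu Hv).
      rewrite bnorm_sqr in Hc. fold N a in Hc.
      apply (Rmult_le_reg_r N); [exact HN'|]. unfold Rdiv.
      rewrite Rmult_assoc, Rinv_l by lra. lra. }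
    replace a with (a / N * N) by (field; lra). apply Rmult_le_compat_r; lra.
Qed.

(* The gradient of [ttheta] in its last argument, with the sum over j <> i completed to
   [grad_theta] so that the value on the diagonal w = y is visible. *)
Definition ttheta_grad (w y : vec) : vec := fun i k =>
  gf i (upd y i (w i)) i k - gf i y i k + grad_theta I gf gg y i k + tau i * (w i k - y i k).

Lemma ttheta_grad_diag x i k : ttheta_grad x x i k = grad_theta I gf gg x i k.
Proof. unfold ttheta_grad. rewrite upd_same. ring. Qed.

(** At fixed y, block i depends on w only through w i, so the estimate is a sum over blocks: c - tau
    i comes from f i and tau i from the proximal term. *)
Lemma ttheta_grad_strongly_monotone : c_tau_pos I nb Xs gf tau ->
  exists c, 0 < c /\ forall w w' y, X w -> X w' -> X y ->
    c * inn (vsub w w') (vsub w w')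
    <= inn (vsub (ttheta_grad w y) (ttheta_grad w' y)) (vsub w w').
Proof.
  intros (c & Hc & H). exists c. split; [exact Hc|]. intros w w' y Hw Hw' Hy.
  unfold inner. rewrite <- fsum_scal. apply fsum_le. intros i Hi.
  assert (Hci := cf_ge_strongly_monotone i y (c - tau i) (w i) (w' i) Hi Hy (Hw i Hi) (Hw' i Hi)
                   (H i Hi y (fun j Hj _ => Hy j Hj))).
  rewrite (binner_sym _ _ (bsub (gf _ _ _) _)) in Hci.
  assert (E : binner (nb i) (vsub (ttheta_grad w y) (ttheta_grad w' y) i) (vsub w w' i)
    = binner (nb i) (fun k => bsub (gf i (upd y i (w i)) i) (gf i (upd y i (w' i)) i) k
                              + tau i * bsub (w i) (w' i) k) (bsub (w i) (w' i))).
  { apply fsum_ext. intros k _. unfold vsub, ttheta_grad, bsub. ring. }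
  rewrite E, binner_plus_l, binner_scal_l.
  change (vsub w w' i) with (bsub (w i) (w' i)). lra.
Qed.

Lemma ttheta_grad_lipschitz :
  (forall i, (i < I)%nat -> lipschitz_on I nb X (gf i) /\ lipschitz_on I nb X (gg i)) ->
  lipschitz2_on I nb X ttheta_grad.
Proof.
  intros Hlip.
  (* In block i both the map [gf i] and its argument depend on i. A sum of masked maps turns this
     into a combination of globally defined Lipschitz maps. *)
  apply (lipschitz2_ext I nb X (fun w y =>
    vadd (fun i k => fsum I (fun j => vsub (gf j y) (gg j y) i k))
         (fun i k => fsum I (fun j =>
            mask j (vadd (vsub (gf j (upd y j (w j))) (gf j y))
                         (vscal (tau j) (vsub w y))) i k)))).
  - intros w y i k Hi. unfold vadd at 1.
    rewrite (fsum_single I i (fun j =>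
      mask j (vadd (vsub (gf j (upd y j (w j))) (gf j y)) (vscal (tau j) (vsub w y))) i k) Hi).
    + unfold mask. rewrite Nat.eqb_refl. unfold ttheta_grad, grad_theta, vadd, vscal, vsub. ring.
    + intros j _ Hj. unfold mask. now rewrite (proj2 (Nat.eqb_neq i j) (not_eq_sym Hj)).
  - assert (Hsnd : forall G, lipschitz_on I nb X G -> lipschitz2_on I nb X (fun _ y => G y)).
    { intros G HG. apply (lipschitz2_comp I nb X G (fun _ y => y)); auto.
      intros w w' y y'. assert (H := vnorm_nonneg I nb (vsub w w')). lra. }
    apply lipschitz2_vadd.
    + apply (lipschitz2_fsum I nb X I (fun j w y => vsub (gf j y) (gg j y))). intros j Hj.
      apply lipschitz2_vsub; apply Hsnd; now apply Hlip.
    + apply (lipschitz2_fsum I nb X I (fun j w y =>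
        mask j (vadd (vsub (gf j (upd y j (w j))) (gf j y)) (vscal (tau j) (vsub w y))))).
      intros j Hj. apply lipschitz2_mask, lipschitz2_vadd; [apply lipschitz2_vsub|].
      * apply (lipschitz2_comp I nb X (gf j) (fun w y => upd y j (w j))); [now apply Hlip| |].
        -- intros w y Hw Hy. apply upd_mem; auto.
        -- intros. apply vnorm_sub_upd.
      * apply Hsnd. now apply Hlip.
      * apply lipschitz2_vscal, lipschitz2_vsub; [apply lipschitz2_fst|apply lipschitz2_snd].
Qed.

(** Along the line, everything except f i is an explicit polynomial C + t b + t^2 q, so only f i
    needs differentiability. *)
Lemma ttheta_i_deriv y w v i : (i < I)%nat -> X y -> Xs i (w i) ->
  derivable_pt_lim (fun t => ttheta_i I nb f g gf gg tau y i (vadd w (vscal t v) i)) 0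
    (binner (nb i) (ttheta_grad w y i) (v i)).
Proof.
  intros Hi Hy Hw.
  destruct (f_C1 i Hi) as (U & _ & HXU & HG & _).
  assert (Hf := derivable_along I nb U (f i) (gf i) (upd y i (w i)) (mask i v) HG
                  (HXU _ (upd_mem y i _ Hy Hw))).
  rewrite inner_mask in Hf by exact Hi.
  set (b := (fsum I (fun j => if Nat.eqb j i then 0 else binner (nb i) (gf j y i) (v i))
             - fsum I (fun j => binner (nb i) (gg j y i) (v i))
             + tau i * binner (nb i) (bsub (w i) (y i)) (v i))).
  assert (HD : binner (nb i) (ttheta_grad w y i) (v i)
               = binner (nb i) (gf i (upd y i (w i)) i) (v i) + (0 + b)).
  { unfold b. rewrite fsum_remove by exact Hi.
    unfold ttheta_grad, grad_theta.
    rewrite !binner_plus_l, binner_minus_l, binner_scal_l, binner_fsum_l.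
    rewrite (fsum_ext I _ (fun j => binner (nb i) (gf j y i) (v i)
                                    - binner (nb i) (gg j y i) (v i)))
      by (intros; apply binner_minus_l).
    rewrite fsum_minus. unfold bsub. ring. }
  rewrite HD.
  set (q := tau i / 2 * binner (nb i) (v i) (v i)).
  set (C := fsum I (fun j => if Nat.eqb j i then 0
                             else binner (nb i) (gf j y i) (bsub (w i) (y i)))
            - g i y - fsum I (fun j => binner (nb i) (gg j y i) (bsub (w i) (y i)))
            + tau i / 2 * binner (nb i) (bsub (w i) (y i)) (bsub (w i) (y i))).
  replace (fun t => ttheta_i I nb f g gf gg tau y i (vadd w (vscal t v) i))
    with (fun t => f i (vadd (upd y i (w i)) (vscal t (mask i v))) + (C + (t * b + t * t * q))).
  { apply (derivable_pt_lim_plus _ _ _ _ _ Hf).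
    apply (derivable_pt_lim_plus (fun _ => C)).
    - apply derivable_pt_lim_const.
    - apply derivable_pt_lim_quadratic. }
  apply functional_extensionality. intros t. unfold ttheta_i.
  replace (upd y i (vadd w (vscal t v) i)) with (vadd (upd y i (w i)) (vscal t (mask i v))).
  2: { do 2 (apply functional_extensionality; intros). unfold vadd, vscal, upd, mask.
       destruct (Nat.eqb_spec x i) as [->|]; ring. }
  assert (Hlin : forall u, binner (nb i) u (bsub (vadd w (vscal t v) i) (y i))
    = binner (nb i) u (bsub (w i) (y i)) + t * binner (nb i) u (v i)).
  { intros u. rewrite !(binner_sym _ u), <- binner_scal_l, <- binner_plus_l.
    apply fsum_ext. intros k _. unfold bsub, vadd, vscal. ring. }
  rewrite bnorm_sqr, !fsum_remove by exact Hi.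
  rewrite !(fsum_ext I (fun j => binner (nb i) _ (bsub (vadd w (vscal t v) i) _))
              (fun j => binner (nb i) _ (bsub (w i) (y i)) + t * binner (nb i) _ (v i)))
    by (intros; apply Hlin).
  rewrite !fsum_plus, !fsum_scal, !Hlin.
  rewrite (binner_sym _ (bsub (vadd w (vscal t v) i) (y i)) (bsub (w i) (y i))), Hlin.
  rewrite (binner_sym _ (bsub (vadd w (vscal t v) i) (y i)) (v i)), Hlin.
  unfold C, b, q. rewrite !fsum_remove by exact Hi.
  rewrite (binner_sym _ (v i) (bsub (w i) (y i))). field.
Qed.

Lemma ttheta_deriv y w v : X y -> X w ->
  derivable_pt_lim (fun t => ttheta I nb f g gf gg tau y (vadd w (vscal t v))) 0
    (inn (ttheta_grad w y) v).
Proof.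
  intros Hy Hw. unfold ttheta, inner. apply derivable_pt_lim_fsum. intros i Hi.
  apply ttheta_i_deriv; auto.
Qed.

Lemma inner_fsum_l m (V : nat -> vec) v :
  inn (fun i k => fsum m (fun j => V j i k)) v = fsum m (fun j => inn (V j) v).
Proof.
  unfold inner. rewrite fsum_swap. apply fsum_ext. intros i _.
  apply (binner_fsum_l (nb i) m (fun j => V j i)).
Qed.

Lemma theta_deriv x v :
  (forall i, (i < I)%nat -> C1_near I nb X (g i) (gg i)) -> X x ->
  derivable_pt_lim (fun t => theta I f g (vadd x (vscal t v))) 0
    (inn (grad_theta I gf gg x) v).
Proof.
  intros g_C1 Hx.
  replace (inn (grad_theta I gf gg x) v)
    with (fsum I (fun i => inn (gf i x) v - inn (gg i x) v)).
  2: { unfold grad_theta. rewrite (inner_fsum_l I (fun j => vsub (gf j x) (gg j x))).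
       apply fsum_ext. intros. symmetry. apply inner_vsub_l. }
  unfold theta. apply derivable_pt_lim_fsum. intros i Hi.
  destruct (f_C1 i Hi) as (U & _ & HXU & HG & _).
  destruct (g_C1 i Hi) as (U' & _ & HXU' & HG' & _).
  apply (derivable_pt_lim_minus (fun t => f i (vadd x (vscal t v)))
                                (fun t => g i (vadd x (vscal t v)))).
  - apply (derivable_along I nb U); auto.
  - apply (derivable_along I nb U'); auto.
Qed.

(** * Feasible set and optimality of the best response *)

Section Feasible.
Context (nc : nat) (h : nat -> vec -> R).
Local Notation Xi := (inXi I Xs nc h).

Lemma inXi_convex :
  (forall j, (j < nc)%nat -> convex_on X (h j)) -> (forall i, (i < I)%nat -> bconvex (Xs i)) ->
  forall x y t, Xi x -> Xi y -> 0 <= t <= 1 -> Xi (vadd x (vscal t (vsub y x))).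
Proof.
  intros Hh HX x y t [Hx Hhx] [Hy Hhy] Ht.
  replace (vadd x (vscal t (vsub y x))) with (vadd (vscal t y) (vscal (1 - t) x)).
  2: { do 2 (apply functional_extensionality; intros). unfold vadd, vscal, vsub; ring. }
  split.
  - intros i Hi. apply (HX i Hi (y i) (x i) t); auto.
  - intros j Hj. specialize (Hh j Hj y x t Hy Hx Ht). specialize (Hhx j Hj).
    specialize (Hhy j Hj). nra.
Qed.

Lemma inXi_closed :
  (forall j, (j < nc)%nat -> continuous_on I nb X (h j)) ->
  (forall i, (i < I)%nat -> bclosed (nb i) (Xs i)) -> vclosed I nb Xi.
Proof.
  intros Hh HX x Hx.
  assert (HxX : X x).
  { intros i Hi. apply (HX i Hi). intros e He. destruct (Hx e He) as (y & [Hy _] & Hyx).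
    exists (y i). split; [auto|]. eapply Rle_lt_trans; [|exact Hyx].
    eapply Rle_trans; [|apply (vnorm_mask I nb i)].
    unfold vnorm. rewrite inner_mask by exact Hi. unfold mask. rewrite Nat.eqb_refl.
    apply Rle_refl. }
  split; [exact HxX|]. intros j Hj. apply Rnot_lt_le. intros Hlt.
  (* The tolerance is the positive value h j x itself: nearby values would then stay positive,
     against feasibility of y. *)
  destruct (Hh j Hj x HxX (h j x) Hlt) as (d & Hd & H).
  destruct (Hx d Hd) as (y & [_ Hy] & Hyx). specialize (H y Hyx). specialize (Hy j Hj).
  apply Rabs_def2 in H. lra.
Qed.

Lemma xhat_variational y xh :
  (forall x y t, Xi x -> Xi y -> 0 <= t <= 1 -> Xi (vadd x (vscal t (vsub y x)))) ->
  X y -> is_xhat I nb Xs nc h f g gf gg tau y xh ->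
  forall w, Xi w -> 0 <= inn (ttheta_grad xh y) (vsub w xh).
Proof.
  intros Hconv Hy [Hxh Hmin] w Hw.
  apply (derivable_pt_lim_min
           (fun t => ttheta I nb f g gf gg tau y (vadd xh (vscal t (vsub w xh))))).
  - apply ttheta_deriv; [exact Hy|apply Hxh].
  - intros t Ht. replace (vadd xh (vscal 0 (vsub w xh))) with xh.
    2: { do 2 (apply functional_extensionality; intros). unfold vadd, vscal; ring. }
    apply Hmin, Hconv; auto. lra.
Qed.

End Feasible.
End BlockDC.

(** * Convergence of the algorithm for (DC) *)

Theorem theorem3
  (I : nat) (nb : nat -> nat) (Xs : nat -> bvec -> Prop)
  (f g : nat -> vec -> R) (gf gg : nat -> vec -> vec)
  (nc : nat) (h : nat -> vec -> R) (gh : nat -> vec -> vec)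
  (tau : nat -> R) (x z : nat -> vec) (gam eps : nat -> R)
  (HI : (1 <= I)%nat)
  (Hnb : forall i, (i < I)%nat -> (1 <= nb i)%nat)
  (* (A1) *)
  (A1f : forall i, (i < I)%nat ->
           convex_on (inX I Xs) (f i) /\ C1_near I nb (inX I Xs) (f i) (gf i))
  (A1g : forall i, (i < I)%nat ->
           convex_on (inX I Xs) (g i) /\ C1_near I nb (inX I Xs) (g i) (gg i))
  (A1h : forall j, (j < nc)%nat ->
           convex_on (inX I Xs) (h j) /\ C1_near I nb (inX I Xs) (h j) (gh j))
  (* (A2) *)
  (A2 : forall i, (i < I)%nat ->
          (exists u, Xs i u) /\ bclosed (nb i) (Xs i) /\ bconvex (Xs i))
  (* (A3) *)
  (A3 : forall i, (i < I)%nat ->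
          lipschitz_on I nb (inX I Xs) (gf i) /\ lipschitz_on I nb (inX I Xs) (gg i))
  (HXi : exists y, inXi I Xs nc h y)
  (Hcoer : coercive_on I nb (inXi I Xs nc h) (theta I f g))
  (Htau : forall i, (i < I)%nat -> 0 <= tau i)
  (Hctau : c_tau_pos I nb Xs gf tau)
  (* Algorithm 2 *)
  (Hx0 : inXi I Xs nc h (x 0%nat))
  (Heps_dec : forall nu, eps (S nu) <= eps nu)
  (Heps_cv : Un_cv eps 0)
  (Hz : forall nu, inXi I Xs nc h (z nu) /\
          exists xh, is_xhat I nb Xs nc h f g gf gg tau (x nu) xh /\
                     vnorm I nb (vsub (z nu) xh) <= eps nu)
  (Hx : forall nu, x (S nu) = vadd (x nu) (vscal (gam nu) (vsub (z nu) (x nu))))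
  (* step-size rules (i)-(v) *)
  (Hg1 : forall nu, 0 < gam nu <= 1)
  (Hg2 : Un_cv gam 0)
  (Hg3 : series_diverges gam)
  (Hg4 : series_converges (fun nu => gam nu ^ 2))
  (Hg5 : series_converges (fun nu => eps nu * gam nu)) :
  (exists nu, stationary I nb Xs nc h gf gg (x nu)) \/
  ((exists xl, limit_point I nb x xl) /\
   forall xl, limit_point I nb x xl -> stationary I nb Xs nc h gf gg xl).
Proof.
  (* The limit-point alternative is established in every case, including runs that pass through a
     stationary iterate. *)
  right.
  assert (Xi_convex := inXi_convex I Xs nc h (fun j Hj => proj1 (A1h j Hj))
                         (fun i Hi => proj2 (proj2 (A2 i Hi)))).
  assert (Xi_closed := inXi_closed I nb Xs nc h
            (fun j Hj => C1_near_continuous I nb _ _ _ (proj2 (A1h j Hj)))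
            (fun i Hi => proj1 (proj2 (A2 i Hi)))).
  assert (f_C1 := fun i Hi => proj2 (A1f i Hi)).
  assert (g_C1 := fun i Hi => proj2 (A1g i Hi)).
  destruct (ttheta_grad_strongly_monotone I nb Xs f gf gg tau
              (fun i Hi => proj1 (A1f i Hi)) f_C1 Hctau) as (c & Hc & Hmono).
  destruct (ttheta_grad_lipschitz I nb Xs gf gg tau A3) as (L & HL & Hlip).
  destruct (choice _ (fun nu => proj2 (Hz nu))) as [xh Hxh].
  assert (HxXi : forall nu, inXi I Xs nc h (x nu)).
  { apply (iterate_mem _ Xi_convex x z gam); auto. apply Hz. }
  assert (Heps : forall nu, 0 <= eps nu).
  { intros nu. eapply Rle_trans; [apply vnorm_nonneg|apply (Hxh nu)]. }
  assert (Heps0 : forall nu, eps nu <= eps 0%nat).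
  { induction nu as [|nu IH]; [lra|]. specialize (Heps_dec nu). lra. }
  destruct (series_bounded (fun nu => eps nu * gam nu)) as [B HB]; [|exact Hg5|].
  { intros nu. specialize (Hg1 nu). apply Rmult_le_pos; [apply Heps|lra]. }
  destruct (limit_points_stationary I nb (inXi I Xs nc h) (theta I f g)
              (ttheta_grad I gf gg tau) c L)
    with (x := x) (z := z) (xh := xh) (gam := gam) (eps := eps) (B0 := eps 0%nat * B)
    as [Hex Hst]; auto.
  - intros a Ha. apply (continuous_fsum I nb (inX I Xs)); [|apply Ha].
    intros i Hi. apply (continuous_minus I nb (inX I Xs));
      eapply C1_near_continuous; eauto.
  (* On the diagonal the surrogate gradient is the gradient of theta; this is the only link between
     T and F. *)
  - intros a b Ha Hb.
    rewrite (inner_ext I nb (ttheta_grad I gf gg tau a a) (grad_theta I gf gg a)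
               (vsub b a) (vsub b a))
      by (intros; split; [apply ttheta_grad_diag|reflexivity]).
    apply (theta_deriv I nb Xs); auto. apply Ha.
  - intros w w' y Hw Hw' Hy. apply Hmono; [apply Hw|apply Hw'|apply Hy].
  - intros w w' y y' Hw Hw' Hy Hy'.
    apply Hlip; [apply Hw|apply Hw'|apply Hy|apply Hy'].
  - intros nu. apply Hz.
  - intros nu. apply (proj1 (Hxh nu)).
  - intros nu. apply (xhat_variational I nb Xs f g gf gg tau f_C1 nc h);
      [exact Xi_convex|apply HxXi|apply (Hxh nu)].
  - intros nu. apply (Hxh nu).
  - intros n. apply Rle_trans with (fsum n (fun k => eps 0%nat * (eps k * gam k))).
    + apply fsum_le. intros k _. specialize (Hg1 k). specialize (Heps k).
      specialize (Heps0 k).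
      replace (gam k * eps k ^ 2) with (eps k * (eps k * gam k)) by ring.
      apply Rmult_le_compat_r; [apply Rmult_le_pos|]; lra.
    + rewrite fsum_scal. apply Rmult_le_compat_l; auto.
  - split; [exact Hex|]. intros xl Hxl. destruct (Hst xl Hxl) as [Hmem HVI].
    split; [exact Hmem|]. intros y Hy. apply Rle_ge.
    rewrite (inner_ext I nb (grad_theta I gf gg xl) (ttheta_grad I gf gg tau xl xl)
               (vsub y xl) (vsub y xl))
      by (intros; split; [symmetry; apply ttheta_grad_diag|reflexivity]).
    now apply HVI.
Qed.
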